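(* Let $Z,W,A_\star,B_\star$, the data points $\{u(t_i),x(t_i),\dot x(t_i)\}_{i=0}^{T-1}$ and $\delta>0$ be as in the context (in particular, the data satisfy $\dot x(t_i)=A_\star Z(x(t_i))+B_\star W(x(t_i))u(t_i)+d(t_i)$ with $|d(t_i)|^2\le\delta$ for all $i$). Let the optimization program (OPT) in the context be feasible, let $\bar{\mathbf A},\bar{\mathbf B}$ be a solution of it, and let $\bar{\boldsymbol\zeta}:=-\bar{\mathbf A}^{-1}\bar{\mathbf B}$, $\bar{\mathbf Q}:=I_n$ and $\bar{\mathcal I}$ be the corresponding objects defined in the context. Suppose there exist a scalar $\mu>0$, a polynomial vector $k:\mathbb R^n\to\mathbb R^m$ with $k(0)=0$, polynomials $\alpha_1,\dots,\alpha_4$ (in one variable $r$), $V$ (in $x\in\mathbb R^n$), $\lambda$ (in $(x,d)\in\mathbb R^n\times\mathbb R^n$), SOS polynomials $s_{\alpha_1}$, $s_{\alpha_2}$ (in $x$), $s_\lambda$ (in $(x,d)$) and an SOS polynomial matrix $S_\nabla$ (in $(x,d)$) such that for all $r\in\mathbb R$, $x\in\mathbb R^n$ and $d\in\mathbb R^n$: (a) for $i=1,\dots,4$, $\alpha_i(r)=\sum_{j=1}^{N_i}c_{ij}r^{2j}$ for some integer $N_i\ge1$ and scalars $c_{i1}\ge0,\dots,c_{iN_i}\ge0$ with $\sum_{j=1}^{N_i}c_{ij}\ge\mu$; (b) $V(x)-\alpha_1(|x|)=s_{\alpha_1}(x)$ and $\alpha_2(|x|)-V(x)=s_{\alpha_2}(x)$;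 (c) $\lambda(x,d)-\mu=s_\lambda(x,d)$; (d) with $\ell(x):=\begin{bmatrix}Z(x)\\ W(x)k(x)\end{bmatrix}$, $$\begin{bmatrix}\alpha_3(|x|)-\alpha_4(|d|)+\frac{\partial V}{\partial x}(x)\big(\bar{\boldsymbol\zeta}^\top \ell(x)+d\big) & \star & \star\\ \bar{\mathbf Q}^{1/2}\frac{\partial V}{\partial x}(x)^\top & -2\lambda(x,d)I & \star\\ \lambda(x,d)\bar{\mathbf A}^{-1/2}\ell(x) & 0 & -2\lambda(x,d)I\end{bmatrix}=-S_\nabla(x,d).$$ Then, for all $[A\ \,B]\in\bar{\mathcal I}$, and in particular for $[A_\star\ \,B_\star]$, the system $$\dot x=[A\ \,B]\begin{bmatrix}Z(x)\\ W(x)k(x)\end{bmatrix}+d$$ is input-to-state stable (ISS) with respect to the process disturbance $d\in\mathbb R^n$.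
   Context: System and libraries. $x\in\mathbb R^n$ is the state and $u\in\mathbb R^m$ the input. $Z:\mathbb R^n\to\mathbb R^N$ and $W:\mathbb R^n\to\mathbb R^{M\times m}$ are known function libraries whose elements are monomials of $x$, with $Z(0)=0$. The actual system is $\dot x=A_\star Z(x)+B_\star W(x)u$ for (unknown) constant matrices $A_\star\in\mathbb R^{n\times N}$, $B_\star\in\mathbb R^{n\times M}$. Data. There are $T$ data points $(u(t_i),x(t_i),\dot x(t_i))\in\mathbb R^m\times\mathbb R^n\times\mathbb R^n$, $i=0,\dots,T-1$, satisfying $\dot x(t_i)=A_\star Z(x(t_i))+B_\star W(x(t_i))u(t_i)+d(t_i)$ for some noise samples with $|d(t_i)|^2\le\delta$, where $\delta>0$ is known. (The disturbance $d$ in the claim's closed-loop system is an arbitrary exogenous input, not restricted by $\delta$.) Optimization program. Let $\ell_i:=\begin{bmatrix}Z(x(t_i))\\ W(x(t_i))u(t_i)\end{bmatrix}$, $\boldsymbol C_i:=\dot x(t_i)\dot x(t_i)^\top-\delta I$, $\boldsymbol B_i:=-\ell_i\dot x(t_i)^\top$, $\boldsymbol A_i:=\ell_i\ell_i^\top$. The program (OPT) is: minimize $-\log\det\bar{\mathbf A}$ over symmetric $\bar{\mathbf A}\in\mathbb R^{(N+M)\times(N+M)}$, $\bar{\mathbf B}\in\mathbb R^{(N+M)\times n}$ and scalars $\tau_0,\dots,\tau_{T-1}$, subject to $\bar{\mathbf A}\succ0$, $\tau_0\ge0,\dots,\tau_{T-1}\ge0$ and $$\begin{bmatrix}-I-\sum_{i}\tau_i\boldsymbol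 C_i&\star&\star\\ \bar{\mathbf B}-\sum_i\tau_i\boldsymbol B_i&\bar{\mathbf A}-\sum_i\tau_i\boldsymbol A_i&\star\\ \bar{\mathbf B}&0&-\bar{\mathbf A}\end{bmatrix}\preceq0.$$ The set $\bar{\mathcal I}$. For a solution $\bar{\mathbf A},\bar{\mathbf B}$ of (OPT), $$\bar{\mathcal I}:=\{[A\ \,B]=\zeta^\top:\ \bar{\mathbf B}^\top\bar{\mathbf A}^{-1}\bar{\mathbf B}+\bar{\mathbf B}^\top\zeta+\zeta^\top\bar{\mathbf B}+\zeta^\top\bar{\mathbf A}\zeta\preceq I\},$$ with $A\in\mathbb R^{n\times N}$, $B\in\mathbb R^{n\times M}$. Equivalently, $\bar{\mathcal I}=\{(\bar{\boldsymbol\zeta}+\bar{\mathbf A}^{-1/2}\Upsilon\bar{\mathbf Q}^{1/2})^\top:\|\Upsilon\|\le1\}$ with $\|\cdot\|$ the induced 2-norm. Notation. $|\cdot|$ is the Euclidean norm; $\succ,\succeq,\preceq$ refer to the semidefinite order on symmetric matrices; $A^{1/2}$ is the positive semidefinite square root; $\star$ denotes the blocks making a matrix symmetric; $\frac{\partial V}{\partial x}$ is the row vector of partial derivatives. A polynomial is SOS if it is a sum of squares of polynomials; a symmetric polynomial matrix $S$ is SOS if $S=R^\top R$ for some polynomial matrix $R$. ISS. A continuous $\gamma:[0,\infty)\to[0,\infty)$ is of class $\mathcal K$ if it is strictly increasing and $\gamma(0)=0$. A continuous $\beta:[0,\infty)\times[0,\infty)\to[0,\infty)$ is of class $\mathcal{KL}$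 if $\beta(\cdot,s)$ is of class $\mathcal K$ for each fixed $s$ and, for each fixed $r$, $\beta(r,\cdot)$ is decreasing with $\lim_{s\to\infty}\beta(r,s)=0$. A system $\dot x=F(x,v)$, $F(0,0)=0$, $F$ locally Lipschitz, with input $v\in\mathbb R^p$, is ISS with respect to $v$ if there exist $\beta$ of class $\mathcal{KL}$ and $\gamma$ of class $\mathcal K$ such that for each $x^\circ\in\mathbb R^n$ and each piecewise continuous bounded $v:[0,\infty)\to\mathbb R^p$, the solution with $x(0)=x^\circ$ satisfies $|x(t)|\le\beta(|x^\circ|,t)+\gamma(\sup_{s\ge0}|v(s)|)$ for all $t\ge0$. *)

(* Defs.v *)
From HB Require Import structures.
From mathcomp Require Import all_boot all_order all_algebra.
From mathcomp Require Import all_classical all_reals all_analysis.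
(* Full import is impossible: the notations of mpoly.v clash with those of
   mathcomp-analysis. *)
From mathcomp Require Import (canonicals, coercions) mpoly.

Set Implicit Arguments.
Unset Strict Implicit.
Unset Printing Implicit Defensive.

Import Order.TTheory GRing.Theory Num.Theory numFieldNormedType.Exports.

Local Open Scope classical_set_scope.
Local Open Scope ring_scope.

Section Matrices.
Variable R : realType.

(* The library norm on matrices is the max norm, hence this definition. *)
Definition enorm (q : nat) (x : 'cV[R]_q) : R :=
  Num.sqrt (\sum_i x i 0 ^+ 2).

Definition psd (q : nat) (A : 'M[R]_q) : Prop :=
  A^T = A /\ forall v : 'cV[R]_q, 0 <= (v^T *m A *m v) 0 0.

Definition pd (q : nat) (A : 'M[R]_q) : Prop :=
  A^T = A /\ forall v : 'cV[R]_q, v != 0 -> 0 < (v^T *m A *m v) 0 0.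

Definition semidef_le (q : nat) (A B : 'M[R]_q) : Prop := psd (B - A).

(* The default value 0 of xget is never reached when A is positive
   semidefinite: the square root then exists and is unique. *)
Definition mxsqrt (q : nat) (A : 'M[R]_q) : 'M[R]_q :=
  xget 0 [set S | psd S /\ S *m S = A].

(* Symmetric 3 x 3 block matrix given by its lower triangular blocks. *)
Definition sym_block3 (p q r : nat) (X11 : 'M[R]_p)
    (X21 : 'M[R]_(q, p)) (X22 : 'M[R]_q)
    (X31 : 'M[R]_(r, p)) (X32 : 'M[R]_(r, q)) (X33 : 'M[R]_r) :
    'M[R]_(p + (q + r)) :=
  block_mx X11 (row_mx X21^T X31^T)
           (col_mx X21 X31) (block_mx X22 X32^T X32 X33).

End Matrices.

Section Polynomials.
Variable R : realType.

Definition peval (n : nat) (x : 'cV[R]_n) (p : mpoly.mpoly n R) : R :=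
  mpoly.meval (fun i => x i 0) p.

Definition pmxeval (n q r : nat) (x : 'cV[R]_n)
    (P : 'M[mpoly.mpoly n R]_(q, r)) : 'M[R]_(q, r) :=
  map_mx (peval x) P.

Definition grad (n : nat) (V : mpoly.mpoly n R) (x : 'cV[R]_n) : 'rV[R]_n :=
  \row_i peval x (mpoly.mderiv i V).

(* A real coefficient is allowed, possibly 0, so that e.g. the identity
   matrix is a matrix of monomials. *)
Definition is_monomial (n : nat) (p : mpoly.mpoly n R) : Prop :=
  exists (c : R) (e : mpoly.multinom n), p = c *: mpoly.mpolyX R e.

Definition is_sos (n : nat) (p : mpoly.mpoly n R) : Prop :=
  exists s : seq (mpoly.mpoly n R), p = \sum_(q <- s) q ^+ 2.

Definition is_sos_mx (n q : nat) (S : 'M[mpoly.mpoly n R]_q) : Prop :=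
  exists (r : nat) (P : 'M[mpoly.mpoly n R]_(r, q)), S = P^T *m P.

Definition is_even_gain (mu : R) (a : {poly R}) : Prop :=
  exists (K : nat) (c : nat -> R),
    [/\ (1 <= K)%N,
        forall j, (1 <= j <= K)%N -> 0 <= c j,
        mu <= \sum_(1 <= j < K.+1) c j &
        forall r : R, a.[r] = \sum_(1 <= j < K.+1) c j * r ^+ (2 * j)].

End Polynomials.

Section Data.
Variables (R : realType) (n m N M T : nat).
Variables (Z : 'cV[mpoly.mpoly n R]_N) (W : 'M[mpoly.mpoly n R]_(M, m)).

Definition regressor (x : 'cV[R]_n) (u : 'cV[R]_m) : 'cV[R]_(N + M) :=
  col_mx (pmxeval x Z) (pmxeval x W *m u).

Variables (delta : R) (us : 'I_T -> 'cV[R]_m) (xs dxs : 'I_T -> 'cV[R]_n).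

Definition data_C (i : 'I_T) : 'M[R]_n :=
  dxs i *m (dxs i)^T - delta%:M.
Definition data_B (i : 'I_T) : 'M[R]_(N + M, n) :=
  - (regressor (xs i) (us i) *m (dxs i)^T).
Definition data_A (i : 'I_T) : 'M[R]_(N + M) :=
  regressor (xs i) (us i) *m (regressor (xs i) (us i))^T.

Definition opt_feasible (A : 'M[R]_(N + M)) (B : 'M[R]_(N + M, n))
    (tau : 'I_T -> R) : Prop :=
  [/\ pd A,
      forall i, 0 <= tau i &
      semidef_le
        (sym_block3
           (- 1%:M - \sum_i tau i *: data_C i)
           (B - \sum_i tau i *: data_B i) (A - \sum_i tau i *: data_A i)
           B 0 (- A))
        0].

Definition opt_solution (A : 'M[R]_(N + M)) (B : 'M[R]_(N + M, n)) : Prop :=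
  exists2 tau, opt_feasible A B tau &
    forall A' B' tau', opt_feasible A' B' tau' ->
      - ln (\det A) <= - ln (\det A').

(* The elements are the matrices [A B], i.e. the transposes of zeta. *)
Definition Ibar (Ab : 'M[R]_(N + M)) (Bb : 'M[R]_(N + M, n)) :
    set 'M[R]_(n, N + M) :=
  [set AB | let zeta := AB^T in
    semidef_le
      (Bb^T *m invmx Ab *m Bb + Bb^T *m zeta + zeta^T *m Bb
       + zeta^T *m Ab *m zeta)
      1%:M].

Definition closed_loop (k : 'cV[mpoly.mpoly n R]_m) (AB : 'M[R]_(n, N + M))
    (x d : 'cV[R]_n) : 'cV[R]_n :=
  AB *m regressor x (pmxeval x k) + d.

End Data.

Section ISS.
Variable R : realType.

Definition classK (g : R -> R) : Prop :=
  [/\ {within [set r | 0 <= r], continuous g},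
      forall r s, 0 <= r -> r < s -> g r < g s &
      g 0 = 0].

(* "Decreasing" in s is nonincreasing: beta 0 s = 0 for every s. *)
Definition classKL (beta : R -> R -> R) : Prop :=
  [/\ {within [set p : R * R | 0 <= p.1 /\ 0 <= p.2],
         continuous (fun p => beta p.1 p.2)},
      forall s, 0 <= s -> classK (beta^~ s),
      forall r s t, 0 <= r -> 0 <= s -> s <= t -> beta r t <= beta r s &
      forall r, 0 <= r -> beta r s @[s --> +oo] --> (0 : R)].

(* Signals on [0, +oo[ are functions on R whose values at negative times
   are never used. *)
Definition piecewise_continuous (p : nat) (v : R -> 'cV[R]_p) : Prop :=
  [/\ forall b : R, exists s : seq R, forall t,
        0 < t < b -> t \notin s -> {for t, continuous v},
      forall t : R, 0 <= t -> cvg (v @ t^'+) &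
      forall t : R, 0 < t -> cvg (v @ t^'-)].

Definition bounded_signal (p : nat) (v : R -> 'cV[R]_p) : Prop :=
  exists C : R, forall t, 0 <= t -> enorm (v t) <= C.

Definition is_solution (n p : nat) (F : 'cV[R]_n -> 'cV[R]_p -> 'cV[R]_n)
    (v : R -> 'cV[R]_p) (x0 : 'cV[R]_n) (x : R -> 'cV[R]_n) : Prop :=
  [/\ x 0 = x0,
      {within [set t | 0 <= t], continuous x} &
      forall t : R, 0 < t -> {for t, continuous v} ->
        is_derive t (1 : R) x (F (x t) (v t))].

(* The standing requirements F 0 0 = 0 and F locally Lipschitz are part of
   the definition, as is the existence of the solution on [0, +oo[. *)
Definition iss (n p : nat) (F : 'cV[R]_n -> 'cV[R]_p -> 'cV[R]_n) : Prop :=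
  [/\ F 0 0 = 0,
      [locally [lipschitz F z.1 z.2 | z in setT]] &
      exists (beta : R -> R -> R) (gamma : R -> R),
        [/\ classKL beta, classK gamma &
            forall (x0 : 'cV[R]_n) (v : R -> 'cV[R]_p),
              piecewise_continuous v -> bounded_signal v ->
              (exists x, is_solution F v x0 x) /\
              forall x, is_solution F v x0 x ->
                forall t, 0 <= t ->
                  enorm (x t) <= beta (enorm x0) t
                    + gamma (sup [set enorm (v s) | s in [set s | 0 <= s]])]].

End ISS.

(* Main.v *)
(** Feasibility of the data LMI, tested at (v, zeta v, Abar^-1 Bbar v) with zeta
    the true parameter, bounds the ellipsoid form at zeta by the residual terms
    tau_i ((d_i . v)^2 - delta |v|^2) <= 0, so the true system lies in the set.
    Conversely, the SOS certificate at each (x, d) is a negative semidefinite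
    block matrix; testing it at a suitable vector and completing the square
    (Petersen's lemma) gives, for every [A B] in the set,
    grad V (A Z + B W k + d) <= alpha4 |d| - alpha3 |x|.

    V is then an ISS Lyapunov function.  All gains are explicit: with s = |x|^2
    and K a large power of two, each alpha_i lies between multiples of
    min(s, s^K) and max(s, s^K), which are inverted up to constants by s + s^K and
    s + s^(1/K); a rational function of (u, t) serves as class KL bound for the
    resulting decay.  Global solutions exist because the vector field clamped to
    a large box is bounded and globally Lipschitz, while the dissipation
    inequality keeps its solutions inside the region where nothing is clamped. *)
Require Import Defs.
From HB Require Import structures.
From mathcomp Require Import all_boot all_order all_algebra.
From mathcomp Require Import all_classical all_reals all_analysis.
From mathcomp Require Import (canonicals, coercions) mpoly.
From mathcomp Require Import measurable_realfun complex ring lra.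

Set Implicit Arguments.
Unset Strict Implicit.
Unset Printing Implicit Defensive.

Import Order.TTheory GRing.Theory Num.Theory numFieldNormedType.Exports.

Local Open Scope classical_set_scope.
Local Open Scope ring_scope.

(** * Square roots of positive semidefinite matrices *)

(** Newton's scheme: a new node is handled by a multiple of the product vanishing at the earlier
    ones. It serves to write a function of the spectrum as a polynomial in the matrix, which keeps
    the result real and symmetric. *)
Lemma interpolation_exists (F : fieldType) (s : seq F) (g : F -> F) :
  exists p : {poly F}, forall x, x \in s -> p.[x] = g x.
Proof.
elim: s => [|x s [p ps]]; first by exists 0.
have [xs|xs] := boolP (x \in s).
  by exists p => y; rewrite inE => /predU1P[->|]; exact: ps.
pose w := \prod_(y <- s) ('X - y%:P).
have wx : w.[x] != 0 by rewrite -[_ == 0]/(root w x) root_prod_XsubC.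
exists (p + ((g x - p.[x]) / w.[x])%:P * w) => y.
rewrite inE => /predU1P[->|ys].
  by rewrite !hornerE divfK// subrKC.
have : root w y by rewrite root_prod_XsubC.
by move=> /rootP wy; rewrite !hornerE wy mulr0 addr0 ps.
Qed.

Lemma trmx_horner_mx (F : comNzRingType) (q : nat) (A : 'M[F]_q.+1)
    (p : {poly F}) : A^T = A -> (horner_mx A p)^T = horner_mx A p.
Proof.
move=> At; elim/poly_ind: p => [|p c ih]; first by rewrite rmorph0 trmx0.
rewrite !rmorphD rmorphM /= horner_mx_X horner_mx_C linearD /= tr_scalar_mx.
rewrite -[_ * A]/(horner_mx A p *m A) trmx_mul ih At; congr (_ + _).
by apply: comm_mx_horner.
Qed.

Section SquareRoot.
Variable R : realType.

Lemma dotE (q : nat) (v : 'cV[R]_q) : (v^T *m v) 0 0 = \sum_i v i 0 ^+ 2.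
Proof. by rewrite mxE; apply: eq_bigr => i _; rewrite mxE expr2. Qed.

Lemma dot_ge0 (q : nat) (v : 'cV[R]_q) : 0 <= (v^T *m v) 0 0.
Proof. by rewrite dotE sumr_ge0// => i _; rewrite sqr_ge0. Qed.

Lemma dot_gt0 (q : nat) (v : 'cV[R]_q) : v != 0 -> 0 < (v^T *m v) 0 0.
Proof.
move=> v0; rewrite lt_neqAle dot_ge0 andbT eq_sym dotE psumr_neq0.
  have /cV0Pn[i vi0] := v0.
  by apply/hasP; exists i; rewrite ?mem_index_enum//= exprn_even_gt0.
by move=> i _; rewrite sqr_ge0.
Qed.

Lemma sqr_enorm (q : nat) (v : 'cV[R]_q) : enorm v ^+ 2 = (v^T *m v) 0 0.
Proof. by rewrite dotE sqr_sqrtr// sumr_ge0// => i _; rewrite sqr_ge0. Qed.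

(** Diagonalisation takes place over the complex numbers, but the root is a real polynomial in [A],
    so only one polynomial identity has to be brought back to the reals. *)
Lemma psd_sqrt_exists (q : nat) (A : 'M[R]_q) : psd A ->
  exists S : 'M[R]_q, psd S /\ S *m S = A.
Proof.
case: q A => [|q] A [At A0].
  exists 0; split; last by rewrite mulmx0 [RHS]flatmx0.
  by split=> [|v]; rewrite ?trmx0// mulmx0 mul0mx mxE.
pose toC := real_complex R; pose Ac := map_mx toC A.
have Ac_herm : Ac \is hermsymmx.
  apply: realsym_hermsym.
    apply/is_hermitianmxP; rewrite expr0 scale1r; apply/matrixP => i j.
    by rewrite !mxE -{1}At mxE.
  by apply/mxOverP => i j; rewrite mxE; apply/complex_realP; exists (A i j).
have /orthomx_spectralP AcE := hermitian_normalmx Ac_herm.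
move/mxOverP: (hermitian_spectral_diag_real Ac_herm).
set D := spectral_diag Ac in AcE *; set P := spectralmx Ac in AcE * => Dreal.
have Punit : P \in unitmx by exact: spectral_unit.
(* A real eigenvalue of the complexified matrix is an eigenvalue of [A] itself, and a real
   eigenvector [v] then gives [0 <= d |v|^2]. *)
have D_ge0 j : exists2 d, 0 <= d & D 0 j = toC d.
  have /complex_realP[d Dd] := Dreal 0 j; exists d => //.
  have : eigenvalue Ac (toC d).
    apply/eigenvalueP; exists (row j P).
      rewrite {1}AcE !mulmxA -row_mul mulmxV// row1 -rowE.
      have -> : row j (diag_mx D) = D 0 j *: delta_mx 0 j.
        by apply/rowP => k; rewrite !mxE eqxx/= (eq_sym k j) mulr_natr.
      by rewrite -scalemxAl -rowE Dd.
    apply/negP => /eqP Pj0; have := @row1 (R[i]) q.+1 j.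
    rewrite -(mulmxV Punit) row_mul Pj0 mul0mx => /matrixP/(_ 0 j).
    by rewrite !mxE !eqxx => /eqP; rewrite eq_sym oner_eq0.
  rewrite eigenvalue_map => /eigenvalueP[v vA v0].
  have : 0 <= d * (v *m v^T) 0 0.
    have := A0 v^T; rewrite trmxK vA -scalemxAl mxE; exact.
  rewrite pmulr_lge0// -{1}(trmxK v) dot_gt0//.
  by apply: contraNneq v0 => /(congr1 trmx)/eqP; rewrite trmxK trmx0.
pose ds := [seq complex.Re (D 0 j) | j <- enum 'I_q.+1].
(* Interpolating the fourth root makes the square root S of A itself the
   square of a symmetric matrix, hence positive semidefinite. *)
have [p pE] := interpolation_exists ds (fun d => Num.sqrt (Num.sqrt d)).
(* [p ^+ 4 - 'X] vanishes at every eigenvalue, hence annihilates the diagonalisable matrix. *)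
have pA4 : horner_mx A (p ^+ 4) = A.
  apply/eqP; rewrite -subr_eq0 -[X in _ - X]horner_mx_X -rmorphB /=.
  rewrite -(map_mx_eq0 toC) map_horner_mx -/Ac AcE horner_mx_uconjC//.
  rewrite horner_mx_diag; apply/eqP.
  rewrite (_ : map_mx _ D = 0) ?linear0 ?mulmx0 ?mul0mx//.
  apply/rowP => j; rewrite !mxE; have [d d0 Dd] := D_ge0 j.
  rewrite Dd horner_map !hornerE pE; last first.
    by apply/mapP; exists j; rewrite ?mem_enum// Dd.
  by rewrite (exprM _ 2 2) !sqr_sqrtr ?sqrtr_ge0// subrr rmorph0.
pose X := horner_mx A p.
have Xt : X^T = X by rewrite trmx_horner_mx.
exists (X *m X); split; first split.
- by rewrite trmx_mul Xt.
- move=> v; have -> : v^T *m (X *m X) *m v = (X *m v)^T *m (X *m v).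
    by rewrite trmx_mul Xt !mulmxA.
  exact: dot_ge0.
- by rewrite -[RHS]pA4 rmorphXn /= mulmxA !exprS expr0 mulr1 -!mulmxE !mulmxA.
Qed.

Lemma mxsqrtP (q : nat) (A : 'M[R]_q) : psd A ->
  psd (mxsqrt A) /\ mxsqrt A *m mxsqrt A = A.
Proof.
by move=> /psd_sqrt_exists[S AS]; rewrite /mxsqrt; case: xgetP => [T _ //|/(_ S)].
Qed.

Lemma pd_psd (q : nat) (A : 'M[R]_q) : pd A -> psd A.
Proof.
move=> [At A0]; split=> // v; have [->|v0] := eqVneq v 0; last exact/ltW/A0.
by rewrite mulmx0 mxE.
Qed.

Lemma pd_unitmx (q : nat) (A : 'M[R]_q) : pd A -> A \in unitmx.
Proof.
move=> [At A0]; rewrite -row_free_unit -kermx_eq0; apply/rowV0P => v /sub_kermxP vA.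
apply/eqP; apply: contraT => v0; have := A0 v^T.
rewrite trmxK vA mul0mx mxE ltxx; apply.
by apply: contraNneq v0 => /(congr1 trmx)/eqP; rewrite trmxK trmx0.
Qed.

End SquareRoot.

(** * Bilinear forms, the data ellipsoid and robust decrease *)

Section Forms.
Variable R : realType.

Definition dot (q : nat) (u v : 'cV[R]_q) : R := (u^T *m v) 0 0.

Definition bil (p q : nat) (A : 'M[R]_(p, q)) (u : 'cV[R]_p) (v : 'cV[R]_q) : R :=
  (u^T *m A *m v) 0 0.

Lemma dotC (q : nat) (u v : 'cV[R]_q) : dot u v = dot v u.
Proof. by rewrite /dot !mxE; apply: eq_bigr => i _; rewrite !mxE mulrC. Qed.

Lemma dotDr (q : nat) (u v w : 'cV[R]_q) : dot u (v + w) = dot u v + dot u w.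
Proof. by rewrite /dot mulmxDr mxE. Qed.

Lemma dotZr (q : nat) (a : R) (u v : 'cV[R]_q) : dot u (a *: v) = a * dot u v.
Proof. by rewrite /dot -scalemxAr mxE. Qed.

Lemma dotNr (q : nat) (u v : 'cV[R]_q) : dot u (- v) = - dot u v.
Proof. by rewrite /dot mulmxN mxE. Qed.

Lemma dotBZ (q : nat) (a b : R) (u v : 'cV[R]_q) :
  dot (a *: u - b *: v) (a *: u - b *: v) =
  a ^+ 2 * dot u u - 2 * a * b * dot u v + b ^+ 2 * dot v v.
Proof.
rewrite -scaleNr dotDr !dotZr dotC dotDr !dotZr [dot (_ + _) v]dotC dotDr !dotZr.
by rewrite [dot v u]dotC; ring.
Qed.

Lemma dotv_ge0 (q : nat) (v : 'cV[R]_q) : 0 <= dot v v.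
Proof. exact: dot_ge0. Qed.

Lemma cauchy_schwarz_dot (q : nat) (u v : 'cV[R]_q) :
  dot u v ^+ 2 <= dot u u * dot v v.
Proof.
have [->|v0] := eqVneq v 0; first by rewrite /dot !mulmx0 !mxE mulr0 expr0n.
have a0 : 0 < dot v v by exact: dot_gt0.
(* The vector is [|v|^2] times the component of [u] orthogonal to [v]. *)
have := dotv_ge0 (dot v v *: u - dot u v *: v); rewrite dotBZ.
have -> : dot v v ^+ 2 * dot u u - 2 * dot v v * dot u v * dot u v +
  dot u v ^+ 2 * dot v v = dot v v * (dot u u * dot v v - dot u v ^+ 2) by ring.
by rewrite pmulr_rge0// subr_ge0.
Qed.

Lemma dot_mulmx (p q : nat) (A : 'M[R]_(p, q)) (u : 'cV[R]_p) (v : 'cV[R]_q) :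
  dot u (A *m v) = bil A u v.
Proof. by rewrite /dot /bil mulmxA. Qed.

Lemma dot_mulmx_tr (p q : nat) (A : 'M[R]_(p, q)) (u : 'cV[R]_p) (v : 'cV[R]_q) :
  dot (A^T *m u) v = bil A u v.
Proof. by rewrite /dot /bil trmx_mul trmxK. Qed.

Lemma bilD (p q : nat) (A B : 'M[R]_(p, q)) u v :
  bil (A + B) u v = bil A u v + bil B u v.
Proof. by rewrite /bil mulmxDr mulmxDl mxE. Qed.

Lemma bilN (p q : nat) (A : 'M[R]_(p, q)) u v : bil (- A) u v = - bil A u v.
Proof. by rewrite /bil mulmxN mulNmx mxE. Qed.

Lemma bilZ (p q : nat) a (A : 'M[R]_(p, q)) u v : bil (a *: A) u v = a * bil A u v.
Proof. by rewrite /bil -scalemxAr -scalemxAl mxE. Qed.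

Lemma bil0 (p q : nat) u v : bil (0 : 'M[R]_(p, q)) u v = 0.
Proof. by rewrite /bil mulmx0 mul0mx mxE. Qed.

Lemma bil_sum (p q T : nat) (A : 'I_T -> 'M[R]_(p, q)) u v :
  bil (\sum_i A i) u v = \sum_i bil (A i) u v.
Proof. by apply: (big_morph (fun A => bil A u v)) => [A1 A2|]; rewrite ?bilD ?bil0. Qed.

Lemma bil_scalar (q : nat) a (u v : 'cV[R]_q) : bil a%:M u v = a * dot u v.
Proof. by rewrite /bil mul_mx_scalar -scalemxAl mxE. Qed.

Lemma bil_rank1 (p q : nat) (x : 'cV[R]_p) (y : 'cV[R]_q) u v :
  bil (x *m y^T) u v = dot x u * dot y v.
Proof.
rewrite /bil mulmxA -mulmxA [dot x u]dotC /dot.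
by rewrite {1}[u^T *m x]mx11_scalar mul_scalar_mx mxE.
Qed.

Lemma bil_tr (p q : nat) (A : 'M[R]_(p, q)) u v : bil A^T u v = bil A v u.
Proof. by rewrite -dot_mulmx dotC dot_mulmx_tr. Qed.

(** Both block inequalities, the data program and the decrease certificate, enter the proof through
    this expansion at a stacked vector. *)
Lemma bil_sym_block3 (p q r : nat) (X11 : 'M[R]_p)
    (X21 : 'M[R]_(q, p)) (X22 : 'M[R]_q)
    (X31 : 'M[R]_(r, p)) (X32 : 'M[R]_(r, q)) (X33 : 'M[R]_r) a b c :
  let v := col_mx a (col_mx b c) in
  bil (sym_block3 X11 X21 X22 X31 X32 X33) v v =
  bil X11 a a + bil X22 b b + bil X33 c c
  + 2 * (bil X21 b a + bil X31 c a + bil X32 c b).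
Proof.
rewrite /= {1}/bil /sym_block3 !tr_col_mx
  !(mul_row_block, mul_row_col, mul_mx_row, add_row_mx).
rewrite !mulmxDl !mxE.
move: (bil_tr X21 a b) (bil_tr X31 a c) (bil_tr X32 b c).
by rewrite /bil !mxE => -> -> ->; ring.
Qed.

Lemma psd_bil_ge0 (q : nat) (A : 'M[R]_q) v : psd A -> 0 <= bil A v v.
Proof. by case=> _; exact. Qed.

Lemma semidef_leP (q : nat) (A B : 'M[R]_q) : A^T = A -> B^T = B ->
  (forall v, bil A v v <= bil B v v) -> semidef_le A B.
Proof.
move=> At Bt AB; split=> [|v]; first by rewrite linearB /= At Bt.
by rewrite -/(bil _ v v) bilD bilN subr_ge0.
Qed.

Lemma semidef_le_bil (q : nat) (A B : 'M[R]_q) v : semidef_le A B ->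
  bil A v v <= bil B v v.
Proof. by move=> /psd_bil_ge0 - /(_ v); rewrite bilD bilN subr_ge0. Qed.

Lemma bil_mulmx (p q r : nat) (A : 'M[R]_(p, q)) (B : 'M[R]_(q, r)) u v :
  bil (A *m B) u v = bil A u (B *m v).
Proof. by rewrite /bil !mulmxA. Qed.

Lemma bil_sqr (q : nat) (A : 'M[R]_q) u : A^T = A ->
  bil (A *m A) u u = dot (A *m u) (A *m u).
Proof. by move=> At; rewrite bil_mulmx -{1}At bil_tr dot_mulmx. Qed.

Section Regression.
Variables (n m N M T : nat).
Variables (Z : 'cV[mpoly.mpoly n R]_N) (W : 'M[mpoly.mpoly n R]_(M, m)).
Variables (delta : R) (us : 'I_T -> 'cV[R]_m) (xs dxs : 'I_T -> 'cV[R]_n).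

(** The three data blocks are the coefficients of one quadratic in [zeta]. At the true parameter the
    residual is the noise sample, so the noise bound and Cauchy-Schwarz make the right-hand side
    nonpositive. *)
Lemma residual_form (i : 'I_T) (zeta : 'M[R]_(N + M, n)) v :
  let l := regressor Z W (xs i) (us i) in
  bil (data_C delta dxs i) v v + 2 * bil (data_B Z W us xs dxs i) (zeta *m v) v
  + bil (data_A Z W us xs i) (zeta *m v) (zeta *m v)
  = dot (dxs i - zeta^T *m l) v ^+ 2 - delta * dot v v.
Proof.
move=> l; rewrite /data_C /data_B /data_A -/l !bilD !bilN !bil_scalar !bil_rank1.
rewrite [dot (_ - _) v]dotC dotDr dotNr.
rewrite [dot v (_ *m l)]dotC dot_mulmx_tr -dot_mulmx [dot v (dxs i)]dotC; ring.
Qed.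

(** The constant term of the ellipsoid form is exactly what completes the square around the centre
    [- invmx Ab *m Bb]. *)
Lemma Ibar_complete_square (Ab : 'M[R]_(N + M)) (Bb : 'M[R]_(N + M, n))
    (AB : 'M[R]_(n, N + M)) v :
  pd Ab -> Ibar Ab Bb AB ->
  bil Ab ((AB^T + invmx Ab *m Bb) *m v) ((AB^T + invmx Ab *m Bb) *m v) <= dot v v.
Proof.
move=> Apd ABI; have [At _] := Apd; have Au := pd_unitmx Apd.
set D := _ *m v.
have := semidef_le_bil v ABI; rewrite bil_scalar mul1r; apply: le_trans.
rewrite trmxK !bilD.
set z := AB^T *m v; set y := invmx Ab *m Bb *m v.
have DE : D = z + y by rewrite /D mulmxDl.
have Ay : Ab *m y = Bb *m v by rewrite /y -mulmxA mulKVmx.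
have zz : bil (AB *m Ab *m AB^T) v v = bil Ab z z.
  by rewrite /bil /z trmx_mul trmxK !mulmxA.
have yy : bil (Bb^T *m invmx Ab *m Bb) v v = dot y (Bb *m v).
  by rewrite /y dotC /bil /dot trmx_mul !mulmxA.
have zB : bil (Bb^T *m AB^T) v v = dot z (Bb *m v).
  by rewrite dotC /bil /dot /z trmx_mul !mulmxA.
have Bz : bil (AB *m Bb) v v = dot z (Bb *m v).
  by rewrite /bil /dot /z trmx_mul trmxK !mulmxA.
rewrite zz yy zB Bz DE -dot_mulmx mulmxDr Ay.
rewrite dotDr [dot (z + y) (Bb *m v)]dotC dotDr [dot (z + y) (Ab *m z)]dotC dotDr.
have -> : dot (Ab *m z) y = dot (Bb *m v) z.
  by rewrite dotC dot_mulmx -bil_tr At -dot_mulmx Ay dotC.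
rewrite -dot_mulmx [dot (Ab *m z) z]dotC [dot _ z]dotC [dot _ y]dotC; lra.
Qed.

Lemma Ibar_true (Astar : 'M[R]_(n, N)) (Bstar : 'M[R]_(n, M))
    (Ab : 'M[R]_(N + M)) (Bb : 'M[R]_(N + M, n)) tau :
  (forall i, exists2 di : 'cV[R]_n,
     enorm di ^+ 2 <= delta &
     dxs i = Astar *m pmxeval (xs i) Z
             + Bstar *m pmxeval (xs i) W *m us i + di) ->
  opt_feasible Z W delta us xs dxs Ab Bb tau ->
  Ibar Ab Bb (row_mx Astar Bstar).
Proof.
move=> data_ok [Apd tau_ge0 lmi]; have [At _] := Apd; have Au := pd_unitmx Apd.
set AB := row_mx Astar Bstar.
have iAt : (invmx Ab)^T = invmx Ab by rewrite trmx_inv At.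
apply: semidef_leP.
- rewrite !linearD /= !trmx_mul !trmxK iAt At !mulmxA; congr (_ + _).
  by rewrite -!addrA; congr (_ + _); rewrite addrC.
- by rewrite trmx1.
move=> v; rewrite bil_scalar mul1r trmxK.
pose z := AB^T *m v; pose y := invmx Ab *m Bb *m v.
have Ay : Ab *m y = Bb *m v by rewrite /y -mulmxA mulKVmx.
(* The last block contributes [2 y.Bb v - y.Ab y], which this [y] maximises: its value there is the
   constant term of the ellipsoid form. This is a Schur complement taken by hand. *)
have := semidef_le_bil (col_mx v (col_mx z y)) lmi.
rewrite bil0 bil_sym_block3 !bilD !bilN !bil0 !bil_sum.
rewrite -(dot_mulmx Ab y) Ay dot_mulmx bil_scalar mul1r.
have zz : bil (AB *m Ab *m AB^T) v v = bil Ab z z.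
  by rewrite /bil /z trmx_mul trmxK !mulmxA.
have yy : bil (Bb^T *m invmx Ab *m Bb) v v = bil Bb y v.
  by rewrite /bil /y !trmx_mul iAt !mulmxA.
have zB : bil (Bb^T *m AB^T) v v = bil Bb z v.
  by rewrite -trmx_mul bil_tr /bil /z trmx_mul trmxK !mulmxA.
have Bz : bil (AB *m Bb) v v = bil Bb z v.
  by rewrite /bil /z trmx_mul trmxK !mulmxA.
rewrite zz yy zB Bz.
suff : \sum_i bil (tau i *: data_C delta dxs i) v v
     + \sum_i bil (tau i *: data_A Z W us xs i) z z
     + 2 * \sum_i bil (tau i *: data_B Z W us xs dxs i) z v <= 0 by lra.
rewrite mulr_sumr -!big_split /= sumr_le0// => i _.
rewrite !bilZ.
have := residual_form i AB^T v; rewrite /= -/z trmxK.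
set c := bil (data_C _ _ _) _ _; set b := bil (data_B _ _ _ _ _ _) _ _.
set a := bil (data_A _ _ _ _ _) _ _ => resE.
have -> : tau i * c + tau i * a + 2 * (tau i * b) = tau i * (c + 2 * b + a) by ring.
rewrite mulr_ge0_le0// resE subr_le0.
have [d dle dE] := data_ok i.
have -> : dxs i - AB *m regressor Z W (xs i) (us i) = d.
  by rewrite dE /AB /regressor mul_row_col mulmxA addrC addKr.
apply: le_trans (cauchy_schwarz_dot _ _) _.
by rewrite ler_wpM2r ?dotv_ge0// /dot -sqr_enorm.
Qed.

End Regression.

(* The direct half of Petersen's lemma: the block matrix is tested at
   (1, S g / (2 lam), S_A^-1 l / 2), and Young's inequality with weight lam
   absorbs the uncertain cross term. *)
Lemma robust_decrease (n q : nat) (Ab : 'M[R]_q) (Bb : 'M[R]_(q, n))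
    (AB : 'M[R]_(n, q)) (S : 'M[R]_n) (SA : 'M[R]_q)
    (g : 'rV[R]_n) (d : 'cV[R]_n) (l : 'cV[R]_q) (c lam : R) :
  pd Ab -> psd S -> S *m S = 1%:M -> psd SA -> SA *m SA = Ab ->
  (forall v, bil Ab ((AB^T + invmx Ab *m Bb) *m v)
                    ((AB^T + invmx Ab *m Bb) *m v) <= dot v v) ->
  0 < lam ->
  (forall v, bil (sym_block3
       (c%:M + g *m ((- (invmx Ab *m Bb))^T *m l + d))
       (S *m g^T) ((- 2 * lam)%:M)
       (lam *: (invmx SA *m l)) 0 ((- 2 * lam)%:M)) v v <= 0) ->
  c + (g *m (AB *m l + d)) 0 0 <= 0.
Proof.
move=> Apd [St _] SS [SAt _] SASA ABle lam0 neg.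
have SAu : SA \in unitmx.
  by have := pd_unitmx Apd; rewrite -SASA unitmx_mul andbb.
set D := AB^T + invmx Ab *m Bb in ABle.
pose w := invmx SA *m l.
have := neg (col_mx 1%:M (col_mx ((2 * lam)^-1 *: (S *m g^T)) (2^-1 *: w))).
rewrite bil_sym_block3 bilD !bil_scalar bil0.
have sc1 (X : 'M[R]_1) : bil X 1%:M 1%:M = X 0 0 by rewrite /bil trmx1 mul1mx mulmx1.
rewrite sc1 [dot 1%:M _]/dot trmx1 mul1mx [1%:M 0 0]mxE /= mulr1.
rewrite !dotZr ![dot (_ *: _) _]dotC !dotZr -!dot_mulmx !mulmx1.
rewrite [dot (_ *: _) (S *m g^T)]dotC [dot (_ *: _) (lam *: _)]dotC !dotZr.
rewrite [dot (lam *: _) _]dotC dotZr -/w.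
have -> : dot (S *m g^T) (S *m g^T) = dot g^T g^T.
  by rewrite /dot trmx_mul St -mulmxA [S *m (S *m _)]mulmxA SS mul1mx.
(* Passing from the centre of the ellipsoid to [AB] costs the cross term [g D^T l]. Inserting [SA]
   and its inverse splits it into a factor bounded by [ABle] and the factor [w] of the
   certificate. *)
have -> : (g *m ((- (invmx Ab *m Bb))^T *m l + d)) 0 0
   = (g *m (AB *m l + d)) 0 0 - dot (SA *m (D *m g^T)) w.
  have -> : AB *m l + d = (- (invmx Ab *m Bb))^T *m l + d + D^T *m l.
    rewrite /D linearD linearN /= trmxK mulmxDl mulNmx.
    by rewrite [AB *m l + _^T *m l]addrC addrACA addNr add0r addrC.
  rewrite [g *m (_ + D^T *m l)]mulmxDr [RHS]addrC [in RHS]mxE.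
  suff -> : dot (SA *m (D *m g^T)) w = (g *m (D^T *m l)) 0 0 by rewrite addrCA addNr addr0.
  rewrite /dot /w !trmx_mul trmxK SAt !mulmxA.
  by rewrite -[_ *m SA *m invmx SA]mulmxA mulmxV// mulmx1.
have := ABle g^T; set e := D *m g^T.
have -> : bil Ab e e = dot (SA *m e) (SA *m e).
  by rewrite -SASA bil_sqr.
set p := SA *m e; set G := dot g^T g^T; set X := (g *m _) 0 0.
move=> pG.
have := dotv_ge0 (1 *: p - lam *: w); rewrite dotBZ.
move=> young H.
(* The quadratic terms at the test vector add up to precisely the Young bound for the cross term. *)
have HE (a b : R) : -2 * lam * ((2 * lam)^-1 * ((2 * lam)^-1 * a)) +
    -2 * lam * (2^-1 * (2^-1 * b)) +
    2 * ((2 * lam)^-1 * a + 2^-1 * (lam * b) + 0) = 2^-1 * (lam^-1 * a + lam * b).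
  by field; rewrite gt_eqF.
have i0 : 0 <= lam^-1 by rewrite invr_ge0 ltW.
have {}pG := ler_wpM2l i0 pG.
have {}young : 0 <= lam^-1 * dot p p - 2 * dot p w + lam * dot w w.
  have -> : lam^-1 * dot p p - 2 * dot p w + lam * dot w w =
    lam^-1 * (1 ^+ 2 * dot p p - 2 * 1 * lam * dot p w + lam ^+ 2 * dot w w).
    by field; rewrite gt_eqF.
  exact: mulr_ge0.
move: H (HE G (dot w w)); rewrite -/X => H HGw.
lra.
Qed.

End Forms.

(** * Polynomial maps *)

Section PolynomialMaps.
Variable R : realType.

(** Induction along ring operations rather than monomials: derivatives, Lipschitz bounds and
    continuity then reduce to constants, variables, sums and products. *)
Lemma mpoly_ring_ind (n : nat) (P : mpoly.mpoly n R -> Prop) :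
  (forall c, P (mpoly.mpolyC n c)) ->
  (forall i, P (mpoly.mpolyX R (mpoly.mnm1 i))) ->
  (forall p q, P p -> P q -> P (p + q)) ->
  (forall p q, P p -> P q -> P (p * q)) -> forall p, P p.
Proof.
move=> PC PX PD PM; elim/mpoly.mpolyind => [|c e p _ _ Pp].
  by rewrite -(mpoly.mpolyC0 n); exact: PC.
apply: (PD _ _ _ Pp); rewrite -mpoly.mul_mpolyC; apply: (PM _ _ (PC c)).
rewrite mpoly.mpolyXE_id.
have P1 : P 1 by rewrite -(mpoly.mpolyC1 n); exact: PC.
apply: (big_ind P) => // i _.
by elim: (e i) => [|j ih]; rewrite ?expr0 ?exprS//; exact: PM.
Qed.

Lemma pevalD (n : nat) (x : 'cV[R]_n) p q : peval x (p + q) = peval x p + peval x q.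
Proof. exact: mpoly.mevalD. Qed.

Lemma pevalM (n : nat) (x : 'cV[R]_n) p q : peval x (p * q) = peval x p * peval x q.
Proof. exact: mpoly.mevalM. Qed.

Lemma pevalC (n : nat) (x : 'cV[R]_n) c : peval x (mpoly.mpolyC n c) = c.
Proof. exact: mpoly.mevalC. Qed.

Lemma pevalX (n : nat) (x : 'cV[R]_n) i : peval x (mpoly.mpolyX R (mpoly.mnm1 i)) = x i 0.
Proof. exact: mpoly.mevalXU. Qed.

Lemma peval_sum (n : nat) (x : 'cV[R]_n) (I : Type) (r : seq I) (F : I -> mpoly.mpoly n R) :
  peval x (\sum_(i <- r) F i) = \sum_(i <- r) peval x (F i).
Proof.
by apply: (big_morph (peval x)) => [p q|]; [exact: pevalD | exact: mpoly.meval0].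
Qed.

Lemma pmxevalM (n p q r : nat) (x : 'cV[R]_n)
    (A : 'M[mpoly.mpoly n R]_(p, q)) (B : 'M[mpoly.mpoly n R]_(q, r)) :
  pmxeval x (A *m B) = pmxeval x A *m pmxeval x B.
Proof.
apply/matrixP => i j; rewrite !mxE peval_sum; apply: eq_bigr => l _.
by rewrite pevalM !mxE.
Qed.

Lemma sos_ge0 (n : nat) (x : 'cV[R]_n) p : is_sos p -> 0 <= peval x p.
Proof.
move=> [s ->]; rewrite peval_sum sumr_ge0// => q _.
by rewrite expr2 pevalM -expr2 sqr_ge0.
Qed.

Lemma sos_mx_ge0 (n q : nat) (x : 'cV[R]_n) (S : 'M[mpoly.mpoly n R]_q) v :
  is_sos_mx S -> 0 <= bil (pmxeval x S) v v.
Proof.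
move=> [r [P ->]]; rewrite pmxevalM bil_mulmx.
have -> : pmxeval x P^T = (pmxeval x P)^T by rewrite /pmxeval map_trmx.
by rewrite bil_tr -dot_mulmx dotv_ge0.
Qed.

Lemma grad_mulmxE (n : nat) (x d : 'cV[R]_n) (p : mpoly.mpoly n R) :
  (grad p x *m d) 0 0 = \sum_i peval x (mpoly.mderiv i p) * d i 0.
Proof. by rewrite mxE; apply: eq_bigr => i _; rewrite mxE. Qed.

Lemma is_derive_coord (n : nat) (x : R -> 'cV[R]_n) (t : R) dx i :
  is_derive t (1 : R) x dx -> is_derive t (1 : R) (fun s => x s i 0) (dx i 0).
Proof.
move=> [dxt <-]; split; first exact: (derivable_mxP _ _ _).1.
by rewrite derive_mx// mxE.
Qed.

Lemma is_derive_cV (n : nat) (x : R -> 'cV[R]_n) (t : R) (dx : 'cV[R]_n) :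
  (forall i, is_derive t (1 : R) (fun s => x s i 0) (dx i 0)) ->
  is_derive t (1 : R) x dx.
Proof.
move=> dxi; have dxt : derivable x t 1.
  by apply/derivable_mxP => i j; rewrite ord1; exact: (@ex_derive _ _ _ _ _ _ _ (dxi i)).
split=> //; rewrite derive_mx//; apply/colP => i; rewrite mxE.
exact: derive_val.
Qed.

Lemma is_derive_peval (n : nat) (x : R -> 'cV[R]_n) (t : R) dx p :
  is_derive t (1 : R) x dx ->
  is_derive t (1 : R) (fun s => peval (x s) p) ((grad p (x t) *m dx) 0 0).
Proof.
move=> dxt; rewrite grad_mulmxE; elim/mpoly_ring_ind: p => [c|i|p q ihp ihq|p q ihp ihq].
- rewrite big1 => [|i _]; last by rewrite mpoly.mderivC /peval mpoly.meval0 mul0r.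
  by under eq_fun do rewrite pevalC; exact: is_derive_cst.
- under eq_fun do rewrite pevalX.
  rewrite (bigD1 i)//= big1 => [|j ji]; last first.
    by rewrite mpoly.mderivX mpoly.mnm1E eq_sym (negbTE ji) scale0r /peval mpoly.meval0 mul0r.
  rewrite mpoly.mderivX mpoly.mnm1E eqxx scale1r addr0 /peval mpoly.mevalX.
  rewrite big1 ?mul1r => [|j _]; first exact: is_derive_coord.
  by rewrite mpoly.mnmBE subnn expr0.
- have -> : (fun s => peval (x s) (p + q)) =
      (fun s => peval (x s) p) + (fun s => peval (x s) q).
    by apply/funext => s; exact: pevalD.
  apply: is_derive_eq (is_deriveD ihp ihq) _.
  by rewrite -big_split /=; apply: eq_bigr => i _; rewrite mpoly.mderivD pevalD mulrDl.
- have -> : (fun s => peval (x s) (p * q)) =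
      (fun s => peval (x s) p) * (fun s => peval (x s) q).
    by apply/funext => s; exact: pevalM.
  apply: is_derive_eq (is_deriveM ihp ihq) _.
  rewrite !scaler_sumr -big_split /=; apply: eq_bigr => i _.
  by rewrite mpoly.mderivM pevalD !pevalM /GRing.scale /=; ring.
Qed.

Lemma coord_le_norm (p q : nat) (x : 'M[R]_(p, q)) i j : `|x i j| <= `|x|.
Proof.
rewrite [leRHS]/Num.Def.normr /= mx_normrE.
exact: (le_bigmax 0 (fun ij : 'I_p * 'I_q => `|x ij.1 ij.2|) (i, j)).
Qed.

Lemma cV_norm_le (n : nat) (x : 'cV[R]_n) e :
  0 <= e -> (forall i, `|x i 0| <= e) -> `|x| <= e.
Proof.
move=> e0 xe; rewrite [leLHS]/Num.Def.normr /= mx_normrE; apply: bigmax_le => // -[i j] _.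
by rewrite /= ord1.
Qed.

(** Bound and Lipschitz estimate go through the induction together, since the product case of the
    second uses the first. A single constant serves for both. *)
Lemma peval_lipschitz (n : nat) (p : mpoly.mpoly n R) (rho : R) : 0 <= rho ->
  exists2 C, 0 <= C &
    (forall x, `|x| <= rho -> `|peval x p| <= C) /\
    (forall x y, `|x| <= rho -> `|y| <= rho ->
       `|peval x p - peval y p| <= C * `|x - y|).
Proof.
move=> rho0; elim/mpoly_ring_ind: p => [c|i|p q [C C0 [Cb Cl]] [D D0 [Db Dl]]
    |p q [C C0 [Cb Cl]] [D D0 [Db Dl]]].
- exists `|c| => //; split=> [x _|x y _ _]; rewrite !pevalC// subrr normr0.
  by rewrite mulr_ge0.
- exists (rho + 1); first by rewrite addr_ge0.
  split=> [x xrho|x y _ _]; rewrite !pevalX.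
    by rewrite (le_trans (coord_le_norm _ _ _))// (le_trans xrho)// lerDl.
  have := coord_le_norm (x - y) i 0; rewrite !mxE => /le_trans; apply.
  by rewrite ler_peMl// lerDr.
- exists (C + D); first by rewrite addr_ge0.
  split=> [x xrho|x y xrho yrho]; rewrite !pevalD.
    by rewrite (le_trans (ler_normD _ _))// lerD ?Cb ?Db.
  by rewrite opprD addrACA mulrDl (le_trans (ler_normD _ _))// lerD ?Cl ?Dl.
- exists (C * D + (C * D + D * C)); first by rewrite !addr_ge0 ?mulr_ge0.
  split=> [x xrho|x y xrho yrho]; rewrite !pevalM.
    by rewrite normrM ler_wpDr ?ler_pM ?Cb ?Db ?addr_ge0 ?mulr_ge0.
  have -> : peval x p * peval x q - peval y p * peval y q =
    peval x p * (peval x q - peval y q) + (peval x p - peval y p) * peval y q by ring.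
  rewrite [leRHS]mulrDl ler_wpDl ?mulr_ge0// [leRHS]mulrDl.
  rewrite (le_trans (ler_normD _ _))// !normrM.
  apply: lerD; first by rewrite -mulrA ler_pM ?Cb ?Dl.
  by rewrite mulrC -mulrA ler_pM ?Db ?Cl.
Qed.

Lemma pmxeval_lipschitz (n m : nat) (q : 'cV[mpoly.mpoly n R]_m) (rho : R) : 0 <= rho ->
  exists2 C, 0 <= C &
    (forall x, `|x| <= rho -> `|pmxeval x q| <= C) /\
    (forall x y, `|x| <= rho -> `|y| <= rho ->
       `|pmxeval x q - pmxeval y q| <= C * `|x - y|).
Proof.
move=> rho0.
have /choice[C CP] : forall i, exists C, 0 <= C /\
    (forall x, `|x| <= rho -> `|peval x (q i 0)| <= C) /\
    (forall x y, `|x| <= rho -> `|y| <= rho ->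
       `|peval x (q i 0) - peval y (q i 0)| <= C * `|x - y|).
  by move=> i; have [C C0 CC] := peval_lipschitz (q i 0) rho0; exists C.
have Cle i : C i <= \sum_j C j.
  by rewrite (bigD1 i)//= lerDl sumr_ge0// => j _; case: (CP j).
have sC : 0 <= \sum_i C i by rewrite sumr_ge0// => i _; case: (CP i).
exists (\sum_i C i) => //; split=> [x xrho|x y xrho yrho].
  apply: cV_norm_le => // i; rewrite mxE (le_trans _ (Cle i))//.
  by case: (CP i) => _ [h _]; exact: h.
apply: cV_norm_le => [|i]; first by rewrite mulr_ge0.
rewrite !mxE (@le_trans _ _ (C i * `|x - y|))//; last by rewrite ler_wpM2r.
by case: (CP i) => _ [_ h]; exact: h.
Qed.

(** Reduces the closed loop to a single polynomial vector field, the form taken by the stability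
    argument. *)
Lemma regressor_pmxeval (n m N M : nat) (Z : 'cV[mpoly.mpoly n R]_N)
    (W : 'M[mpoly.mpoly n R]_(M, m)) (k : 'cV[mpoly.mpoly n R]_m)
    (AB : 'M[R]_(n, N + M)) :
  exists q : 'cV[mpoly.mpoly n R]_n, forall x,
    AB *m regressor Z W x (pmxeval x k) = pmxeval x q.
Proof.
exists (map_mx (@mpoly.mpolyC n R) AB *m col_mx Z (W *m k)) => x.
rewrite pmxevalM; congr (_ *m _).
  by apply/matrixP => i j; rewrite !mxE pevalC.
by rewrite /regressor -pmxevalM /pmxeval map_col_mx.
Qed.

End PolynomialMaps.

(** * Comparison lemmas for scalar functions *)

Section Comparison.
Variable R : realType.
Implicit Types w : R -> R.

(** Freezing a trajectory at its initial value for negative times gives a function continuous on the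
    whole line, as the comparison lemmas require. *)
Lemma continuous_clamp0 (T : topologicalType) (x : R -> T) :
  {within [set t | 0 <= t], continuous x} -> continuous (fun t : R => x (Num.max 0 t)).
Proof.
move=> /subspace_continuousP xc t.
have c0 : {for t, continuous (fun t : R => Num.max 0 t)}.
  by apply: continuous_max; [exact: cst_continuous | exact: cvg_id].
have m0 : 0 <= Num.max 0 t by rewrite le_max lexx.
apply: cvg_comp (xc _ m0) => U; rewrite /within /= => /c0 h.
apply: (@filterS _ (nbhs t) _ _ _ _ h) => s; apply.
by rewrite /= le_max lexx.
Qed.

(** The exceptional points, in practice the jumps of the input, are removed one at a time by
    splitting the interval there and adding the two estimates. *)
Lemma mean_value_le_finite (w : R -> R) (a b c : R) (s : seq R) :
  continuous w -> a <= b ->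
  (forall t, a < t < b -> t \notin s ->
     exists2 dw, is_derive t (1 : R) w dw & dw <= c) ->
  w b - w a <= c * (b - a).
Proof.
move=> wc; elim: s a b => [|p s ih] a b ab dw.
  have [->|a_b] := eqVneq a b; first by rewrite !subrr mulr0.
  have altb : a < b by rewrite lt_neqAle a_b.
  have wd t : t \in `]a, b[ -> is_derive t (1 : R) w ('D_1 w t).
    rewrite in_itv/= => /dw/(_ isT)[d [wd _] _]; exact: derivableP.
  have [t tab ->] := MVT altb wd (continuous_subspaceT wc).
  have /dw/(_ isT)[d [_ <-] dc] : a < t < b by move: tab; rewrite in_itv.
  by rewrite ler_wpM2r// subr_ge0.
have [/andP[ap pb]|pab] := boolP (a < p < b).
  have -> : w b - w a = (w b - w p) + (w p - w a) by ring.
  have -> : c * (b - a) = c * (b - p) + c * (p - a) by ring.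
  apply: lerD; apply: ih; rewrite ?ltW// => t /andP[t1 t2] ts; apply: dw.
  - by rewrite (lt_trans ap).
  - by rewrite inE negb_or ts gt_eqF.
  - by rewrite t1 (lt_trans t2).
  - by rewrite inE negb_or ts lt_eqF.
apply: ih => // t tab ts; apply: dw => //.
by rewrite inE negb_or ts andbT; apply: contraNneq pab => <-.
Qed.

(** [t0] is the supremum of the times in the sublevel set, which continuity keeps in that set. After
    [t0] any inequality known only above level [c] becomes available. *)
Lemma last_exit (w : R -> R) (a b c : R) :
  continuous w -> a <= b -> w a <= c -> c < w b ->
  exists t0, [/\ a <= t0, t0 < b, w t0 <= c & forall t, t0 < t <= b -> c < w t].
Proof.
move=> wc ab wa wb; pose A := [set t | a <= t <= b /\ w t <= c].
have Aa : A a by split=> //; rewrite lexx.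
have supA : has_sup A by split; [exists a|exists b => t [/andP[]]].
have at0 : a <= sup A by exact: (ub_le_sup supA.2).
have t0b : sup A <= b by apply: ge_sup; [exists a|move=> t [/andP[]]].
have wt0 : w (sup A) <= c.
  rewrite leNgt; apply/negP => cw.
  have /nbhs_ballP[e /= e0 we] : \forall t \near sup A, c < w t.
    by have /cvgr_gt := wc (sup A); apply.
  have [t At] := sup_adherent e0 supA; have tsup := ub_le_sup supA.2 At.
  move=> lt; have : c < w t.
    by apply: we; rewrite /ball /= ger0_norm ?subr_ge0// ltrBlDr -ltrBlDl.
  by rewrite ltNge; case: At => _ ->.
exists (sup A); split=> //.
  by rewrite lt_neqAle t0b andbT; apply: contraTneq wb => <-; rewrite -leNgt.
move=> t /andP[t0t tb]; rewrite ltNge; apply/negP => wt.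
have /(ub_le_sup supA.2) : A t by split=> //; rewrite tb (le_trans at0)// ltW.
by rewrite leNgt t0t.
Qed.

(** To cross level [c], [w] would have to increase inside the band just above it. Asking for
    decrease only in this band lets the lemma apply to a clamped field, which agrees with the true
    one only on a bounded region. *)
Lemma barrier (w : R -> R) (c : R) : continuous w -> w 0 <= c ->
  (forall b, exists s : seq R, forall t, 0 < t < b -> t \notin s ->
     c < w t < c + 1 -> exists2 dw, is_derive t (1 : R) w dw & dw <= 0) ->
  forall t, 0 <= t -> w t <= c.
Proof.
move=> wc w0 dw t t0; rewrite leNgt; apply/negP => cw.
have [a [a0 at_ wa wgt]] := last_exit wc t0 w0 cw.
have /nbhs_ballP[e /= e0 we] : \forall u \near a, w u < c + 1.
  have /cvgr_lt := wc a; apply.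
  by rewrite (le_lt_trans wa)// ltrDl.
(* [b] comes after the last time at or below level [c], yet so soon that [w] has not left the
   band. *)
pose b := Num.min t (a + e / 2).
have ab : a < b by rewrite lt_min at_ ltrDl divr_gt0.
have bt : b <= t by rewrite ge_min lexx.
have [s ds] := dw t.
have : w b - w a <= 0 * (b - a).
  apply: (mean_value_le_finite (s := s) wc (ltW ab)) => u /andP[au ub] us.
  apply: ds => //; first by rewrite (le_lt_trans a0 au) (lt_le_trans ub bt).
  rewrite wgt ?au ?(ltW (lt_le_trans ub bt))//=; apply: we.
  rewrite /ball /= distrC gtr0_norm ?subr_gt0// ltrBlDl.
  rewrite (lt_le_trans ub)// ge_min; apply/orP; right; rewrite lerD2l; lra.
rewrite mul0r subr_le0 => /le_trans/(_ wa); rewrite leNgt wgt// bt andbT//.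
Qed.

(** If [w] had ever been at or below [eta], the last such time would forbid it to be above now;
    otherwise it has been falling at rate [a] since time 0. *)
Lemma decay (w : R -> R) (eta a : R) : continuous w -> 0 <= a ->
  (forall b, exists s : seq R, forall t, 0 < t < b -> t \notin s ->
     eta < w t -> exists2 dw, is_derive t (1 : R) w dw & dw <= - a) ->
  forall t, 0 <= t -> w t <= Num.max eta (w 0 - a * t).
Proof.
move=> wc a0 dw t t0; rewrite le_max; case: (leP (w t) eta) => //= etaw.
have [s ds] := dw t.
have drop r : 0 <= r -> r <= t -> (forall u, r < u < t -> eta < w u) ->
    w t - w r <= - a * (t - r).
  move=> r0 rt wu; apply: (mean_value_le_finite (s := s) wc rt) => u ru us.
  apply: ds => //; last exact: wu.
  by case/andP: ru => ru ->; rewrite (le_lt_trans r0 ru).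
have [[r [r0 rt wr]]|noex] := pselect (exists r, [/\ 0 <= r, r <= t & w r <= eta]).
  have [p [rp pt wp wgt]] := last_exit wc rt wr etaw.
  have := drop p (le_trans r0 rp) (ltW pt).
  have h u : p < u < t -> eta < w u.
    by case/andP => pu ut; apply: wgt; rewrite pu ltW.
  move=> /(_ h); have : 0 <= a * (t - p) by rewrite mulr_ge0// subr_ge0 ltW.
  lra.
have : w t - w 0 <= - a * (t - 0).
  apply: drop => // u /andP[u0 ut]; rewrite ltNge; apply/negP => wu.
  by apply: noex; exists u; split=> //; exact: ltW.
lra.
Qed.

End Comparison.

(** * Primitives of piecewise continuous signals *)

Section Primitives.
Variable R : realType.
Notation mu := (@lebesgue_measure R).

Lemma measurable_fun_finite_discont (f : R -> R) (a b : R) (s : seq R) :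
  (forall t, a < t < b -> t \notin s -> {for t, continuous f}) ->
  measurable_fun `]a, b[ f.
Proof.
elim: s a b => [|p s ih] a b fc.
  apply: open_continuous_measurable_fun; first exact: interval_open.
  by move=> t; rewrite inE/= in_itv/= => tab; exact: fc.
have [/andP[ap pb]|pab] := boolP (a < p < b); last first.
  apply: ih => t tab ts; apply: fc => //.
  by rewrite inE negb_or ts andbT; apply: contraNneq pab => <-.
have -> : `]a, b[%classic = `]a, p[ `|` ([set p] `|` `]p, b[).
  apply/seteqP; split=> t /=; rewrite !in_itv/=.
    move=> /andP[at_ tb]; case: (ltgtP t p) => tp; first by left; rewrite at_.
      by right; right.
    by right; left.
  case=> [/andP[-> tp]|[->|/andP[pt ->]]]; first by rewrite (lt_trans tp).
    by rewrite ap.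
  by rewrite (lt_trans ap).
have mU : measurable ([set p] `|` `]p, b[).
  by apply: measurableU; [exact: measurable_set1|exact: measurable_itv].
apply/measurable_funU => //; split; last first.
  apply/measurable_funU => //; split; first exact: measurable_fun_set1.
  apply: ih => t /andP[pt tb] ts; apply: fc; first by rewrite tb (lt_trans ap).
  by rewrite inE negb_or ts gt_eqF.
apply: ih => t /andP[at_ tp] ts; apply: fc; first by rewrite at_ (lt_trans tp).
by rewrite inE negb_or ts lt_eqF.
Qed.

Lemma integrable_finite_discont (f : R -> R) (C : R) :
  (forall b, exists s : seq R, forall t, 0 < t < b -> t \notin s ->
     {for t, continuous f}) ->
  (forall t, 0 <= t -> `|f t| <= C) ->
  forall b, mu.-integrable `[0, b] (EFin \o f).
Proof.
move=> fc fC b; apply: measurable_bounded_integrable => //.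
- have h : (mu `[0%R, b] < +oo)%E.
    by rewrite lebesgue_measure_itv/=; case: ifP; rewrite -?EFinB ltry.
  exact: h.
(* Discontinuities are listed up to [b + 1] so that the endpoint [b] is interior; the endpoint 0 is
   added as a single point. *)
- have [s sc] := fc (b + 1).
  apply: (@measurable_funS _ _ _ _ ([set 0] `|` `]0, b + 1[)).
  + by apply: measurableU; [exact: measurable_set1|exact: measurable_itv].
  + move=> t /=; rewrite !in_itv/= => /andP[t0 tb].
    move: t0; rewrite le_eqVlt => /predU1P[<-|t0]; first by left.
    by right; rewrite t0 (le_lt_trans tb)// ltrDl.
  + apply/measurable_funU => //; split; first exact: measurable_fun_set1.
    exact: measurable_fun_finite_discont sc.
- exists C; split=> [|M CM t /=]; first exact: num_real.
  by rewrite in_itv/= => /andP[t0 _]; rewrite (le_trans (fC t t0))// ltW.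
Qed.

(** The integral from 0, kept constant at negative times. It is differentiable wherever [f] is
    continuous, which matches the notion of solution at the jumps of the input. *)
Lemma primitive_exists (f : R -> R) :
  (forall b, mu.-integrable `[0, b] (EFin \o f)) ->
  exists F : R -> R, [/\ continuous F, F 0 = 0 &
    forall t, 0 < t -> {for t, continuous f} -> is_derive t (1 : R) F (f t)].
Proof.
move=> fi; pose G x := parameterized_integral mu 0 x f.
have Gc : {within [set t | 0 <= t], continuous G}.
  apply/subspace_continuousP => t /= t0.
  have tp : 0 <= t + 1 by rewrite addr_ge0.
  have /subspace_continuousP/(_ t) := parameterized_integral_continuous tp (fi (t + 1)).
  rewrite /= in_itv/= t0 lerDl ler01 => /(_ isT) Gt U /Gt.
  rewrite /fmap /= /within /=.
  have near1 : \forall s \near t, s <= t + 1.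
    near=> s; apply/ltW; near: s; apply: lt_nbhsl; rewrite ltrDl//.
  move=> h; apply: filterS2 near1 h => s s1 hs s0; apply: hs.
  by rewrite in_itv/= s0.
exists (fun t => G (Num.max 0 t)); split.
- exact: continuous_clamp0 Gc.
- by rewrite maxxx /G /parameterized_integral set_itv1 Rintegral_set1.
move=> t t0 ft; have tt1 : t < t + 1 by rewrite ltrDl.
have [Gd Gf] := continuous_FTC1_closed tt1 (fi _) t0 ft.
apply: (@near_eq_is_derive _ _ _ G).
  near=> s; rewrite max_r//; apply/ltW; near: s; exact: lt_nbhsr.
by split=> //; rewrite -derive1E.
Unshelve. all: by end_near. Qed.

Lemma continuous_cV (T : topologicalType) (n : nat) (x : T -> 'cV[R]_n) (t : T) :
  (forall i, {for t, continuous (fun s => x s i 0)}) -> {for t, continuous x}.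
Proof.
move=> xc; apply/cvgrPdist_le => e e0; near=> s.
apply: cV_norm_le => [|i]; first exact: ltW.
rewrite !mxE; move: i; near: s; apply: filter_forall => i.
exact: (cvgrPdist_le _ _).1 (xc i) _ e0.
Unshelve. all: by end_near. Qed.

Lemma continuous_coord (T : topologicalType) (n : nat) (x : T -> 'cV[R]_n) (t : T) i :
  {for t, continuous x} -> {for t, continuous (fun s => x s i 0)}.
Proof.
move=> xc; apply: (continuous_comp (f := x) (g := fun y : 'cV[R]_n => y i 0)) => //.
exact: coord_continuous.
Qed.

Lemma cV_primitive_exists (n : nat) (f : R -> 'cV[R]_n) :
  (forall i b, mu.-integrable `[0, b] (EFin \o (fun t => f t i 0))) ->
  exists F : R -> 'cV[R]_n, [/\ continuous F, F 0 = 0 &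
    forall t, 0 < t -> {for t, continuous f} -> is_derive t (1 : R) F (f t)].
Proof.
move=> fi; have /choice[F FP] := fun i => primitive_exists (fi i).
exists (fun t => \col_i F i t); split.
- move=> t; apply: continuous_cV => i; have [Fc _ _] := FP i.
  have -> : (fun s => (\col_i F i s : 'cV[R]_n) i 0) = F i; last exact: Fc.
  by apply/funext => s; rewrite mxE.
- by apply/colP => i; rewrite !mxE; case: (FP i).
move=> t t0 ft; apply: is_derive_cV => i; have [_ _ Fd] := FP i.
under eq_fun do rewrite mxE.
by apply: Fd => //; exact: continuous_coord.
Qed.

Lemma cV_continuous_primitive (n : nat) (f : R -> 'cV[R]_n) : continuous f ->
  exists F : R -> 'cV[R]_n, [/\ continuous F, F 0 = 0 &
    forall t : R, 0 < t -> is_derive t (1 : R) F (f t : 'cV[R]_n)].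
Proof.
move=> fc; have [|F [Fc F0 Fd]] := @cV_primitive_exists n f; last first.
  by exists F; split=> // t t0; apply: Fd => //; exact: fc.
move=> i b; apply: continuous_compact_integrable; first exact: segment_compact.
by apply: continuous_subspaceT => t; apply: continuous_coord; exact: fc.
Qed.

End Primitives.

(** * Global Picard iteration *)

Section Picard.
Variable R : realType.

Lemma pow_half_small (c e : R) : 0 < e -> exists k : nat, c * 2^-1 ^+ k <= e.
Proof.
move=> e0; exists (Num.Def.archi_bound `|c / e|).
set k := Num.Def.archi_bound _.
have ck : c / e < k%:R by rewrite (le_lt_trans (ler_norm _))// archi_boundP.
rewrite exprVn ler_pdivrMr ?exprn_gt0// -ler_pdivrMl// mulrC (le_trans (ltW ck))//.
by rewrite -natrX ler_nat ltnW// ltn_expl.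
Qed.

(** Subtracting and adding the tail of the series yields an increasing and a decreasing sequence
    that enclose the limit, hence an explicit rate of convergence. *)
Lemma geometric_limit (u : nat -> R) (c : R) : 0 <= c ->
  (forall k, `|u k.+1 - u k| <= c * 2^-1 ^+ k) ->
  exists l, forall k, `|u k - l| <= 2 * c * 2^-1 ^+ k.
Proof.
move=> c0 uc.
pose a k := u k - 2 * c * 2^-1 ^+ k; pose b k := u k + 2 * c * 2^-1 ^+ k.
have half k : 2^-1 ^+ k.+1 = 2^-1 * 2^-1 ^+ k :> R by rewrite exprS.
have incra : {homo a : m n / (m <= n)%N >-> m <= n}.
  apply/nondecreasing_seqP => k; have := uc k.
  by rewrite ler_norml => /andP[h _]; rewrite /a half; lra.
have decrb : {homo b : m n / (m <= n)%N >-> n <= m}.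
  apply/nonincreasing_seqP => k; have := uc k.
  by rewrite ler_norml => /andP[_ h]; rewrite /b half; lra.
have p0 k : 0 <= 2 * c * 2^-1 ^+ k by rewrite !mulr_ge0// exprn_ge0.
have ab j k : a j <= b k.
  apply: le_trans (incra j (maxn j k) (leq_maxl _ _)) _.
  apply: le_trans (decrb k (maxn j k) (leq_maxr _ _)).
  by rewrite /a /b; have := p0 (maxn j k); lra.
have supa : has_sup (range a) by split; [exists (a 0%N), 0%N|exists (b 0%N) => _ [j _ <-]].
exists (sup (range a)) => k.
have h1 : a k <= sup (range a) by apply: (ub_le_sup supa.2); exists k.
have h2 : sup (range a) <= b k by apply: (ge_sup supa.1) => _ [j _ <-].
by rewrite ler_norml; rewrite /a /b in h1 h2; apply/andP; split; lra.
Qed.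

Variables (n : nat).

(** Each coordinate, with either sign, is compared with [K exp (2 L t)], whose derivative is the
    assumed bound on [f]. *)
Lemma norm_le_of_derive (X f : R -> 'cV[R]_n) (K L : R) :
  0 <= K -> 0 < L -> continuous X -> X 0 = 0 ->
  (forall t : R, 0 < t -> is_derive t (1 : R) X (f t)) ->
  (forall t, 0 < t -> `|f t| <= 2 * L * K * expR (2 * L * t)) ->
  forall t, 0 <= t -> `|X t| <= K * expR (2 * L * t).
Proof.
move=> K0 L0 Xc X0 Xd fK t t0.
pose E (s : R) := K * expR (2 * L * s).
have Ed s : is_derive s (1 : R) E (2 * L * K * expR (2 * L * s)).
  have h1 : is_derive s (1 : R) (fun s : R => 2 * L * s) (2 * L).
    have := is_deriveZ (2 * L) (is_derive_id s (1 : R)).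
    by rewrite [X in is_derive _ _ _ X -> _]mulr1.
  have := is_deriveZ K (is_derive1_comp (is_derive_expR (2 * L * s)) h1).
  by move=> h; apply: is_derive_eq h _; rewrite /GRing.scale /=; ring.
have Ec : continuous E.
  by move=> s; apply/differentiable_continuous/derivable1_diffP; exact: ex_derive.
have E0 : E 0 = K by rewrite /E mulr0 expR0 mulr1.
have coord i (sg : R) : `|sg| = 1 -> sg * X t i 0 <= E t.
  move=> sg1.
  have := @mean_value_le_finite R (fun s => sg * X s i 0 - E s) 0 t 0 [::].
  rewrite mul0r X0 mxE mulr0 E0 => /(_ _ t0) H.
  suff : sg * X t i 0 - E t - (0 - K) <= 0 by lra.
  apply: H => [s|s /andP[s0 _] _].
    apply: cvgB; last exact: Ec.
    by apply: cvgM; [exact: cvg_cst|apply: continuous_coord; exact: Xc].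
  exists (sg * f s i 0 - 2 * L * K * expR (2 * L * s)).
    exact: (is_deriveB (is_deriveZ sg (is_derive_coord i (Xd s s0))) (Ed s)).
  rewrite subr_le0 (le_trans _ (fK s s0))// (le_trans _ (coord_le_norm _ i 0))//.
  by rewrite (le_trans (ler_norm _))// normrM sg1 mul1r.
apply: cV_norm_le => [|i]; first by rewrite mulr_ge0// ?expR_ge0.
rewrite ler_norml; apply/andP; split.
  have := coord i (-1); rewrite normrN1 => /(_ erefl); rewrite /E; lra.
by have := coord i 1; rewrite normr1 => /(_ erefl); rewrite mul1r.
Qed.

(* Weighting by exp (2 L t) makes each Picard step contract by 1/2 on the whole
   half line, so that no extension of local solutions is needed. *)
Lemma picard_global (h : R -> 'cV[R]_n -> 'cV[R]_n) (L G : R) (x0 : 'cV[R]_n) :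
  0 < L -> 0 <= G ->
  (forall y : R -> 'cV[R]_n, continuous y -> continuous (fun t => h t (y t))) ->
  (forall t y z, `|h t y - h t z| <= L * `|y - z|) ->
  (forall t y, `|h t y| <= G) ->
  exists x : R -> 'cV[R]_n, [/\ continuous x, x 0 = x0 &
    forall t : R, 0 < t -> is_derive t (1 : R) x (h t (x t))].
Proof.
move=> L0 G0 hc hL hG.
(* The Picard operator is made total by a dummy value at discontinuous [y]; all the iterates below
   are continuous. *)
have /choice[S SP] : forall y : R -> 'cV[R]_n, exists Sy : R -> 'cV[R]_n,
    continuous y -> [/\ continuous Sy, Sy 0 = x0 &
    forall t : R, 0 < t -> is_derive t (1 : R) Sy (h t (y t))].
  move=> y; have [yc|nyc] := pselect (continuous y); last by exists y.
  have [F [Fc F0 Fd]] := cV_continuous_primitive (hc y yc).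
  exists (fun t => x0 + F t) => _; split=> [t||t t0].
  - by apply: continuousD; [exact: cst_continuous|exact: Fc].
  - by rewrite F0 addr0.
  - have := is_deriveD (is_derive_cst x0 t (1 : R)) (Fd t t0).
    by rewrite add0r.
have Scmp (y z : R -> 'cV[R]_n) K : 0 <= K -> continuous y -> continuous z ->
    (forall t, 0 < t -> `|y t - z t| <= 2 * K * expR (2 * L * t)) ->
    forall t, 0 <= t -> `|S y t - S z t| <= K * expR (2 * L * t).
  move=> K0 /SP[Syc Sy0 Syd] /SP[Szc Sz0 Szd] yz.
  apply: (norm_le_of_derive (X := fun t => S y t - S z t)
    (f := fun t => h t (y t) - h t (z t)) K0 L0).
  - by move=> t; apply: continuousB; [exact: Syc|exact: Szc].
  - by rewrite Sy0 Sz0 subrr.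
  - by move=> t t0; exact: is_deriveB (Syd t t0) (Szd t t0).
  - move=> t t0; rewrite (le_trans (hL _ _ _))//.
    by have := ler_wpM2l (ltW L0) (yz t t0); lra.
pose xs k := iter k S (fun=> x0).
have xsc k : continuous (xs k).
  elim: k => [|k ih]; first exact: cst_continuous.
  by have [] := SP _ ih.
(* With this [K] the bound [G] on the field is at most [2 L K exp (2 L t)], which controls the first
   step. *)
pose K := G / (2 * L).
have K0 : 0 <= K by rewrite divr_ge0// mulr_ge0// ltW.
have p2 k : 0 <= 2^-1 ^+ k :> R by rewrite exprn_ge0.
have step k t : 0 <= t -> `|xs k.+1 t - xs k t| <= K * expR (2 * L * t) * 2^-1 ^+ k.
  elim: k t => [|k ih] t t0; last first.
    rewrite mulrAC; apply: (Scmp _ _ _ _ (xsc k.+1) (xsc k)) => //.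
      by rewrite mulr_ge0.
    by move=> s s0; have := ih s (ltW s0); rewrite exprS; lra.
  have [Sc S0 Sd] := SP _ (xsc 0%N).
  rewrite expr0 mulr1.
  apply: (norm_le_of_derive (X := fun t => xs 1%N t - x0)
    (f := fun t => h t x0) K0 L0) => //.
  - by move=> s; apply: continuousB; [exact: Sc|exact: cst_continuous].
  - by rewrite /xs /= S0 subrr.
  - move=> s s0; have := is_deriveB (Sd s s0) (is_derive_cst x0 s (1 : R)).
    by rewrite subr0.
  - move=> s s0; rewrite (le_trans (hG _ _))// /K.
    have -> : 2 * L * (G / (2 * L)) = G by field; rewrite gt_eqF.
    by rewrite ler_peMr// -expR0 ler_expR mulr_ge0 ?mulr_ge0// ltW.
(* Twice the bound on the first step, that is, the sum of the geometric series of steps. *)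
pose B t := 2 * (K * expR (2 * L * t)).
have Bge0 t : 0 <= B t.
  by apply: mulr_ge0 => //; apply: mulr_ge0 => //; exact: expR_ge0.
have /choice[z zP] : forall t, exists z : 'cV[R]_n, forall k, 0 <= t ->
    `|xs k t - z| <= B t * 2^-1 ^+ k.
  move=> t; have [t0|t0] := leP 0 t; last by exists 0.
  have /choice[l lP] : forall i, exists l, forall k,
      `|xs k t i 0 - l| <= B t * 2^-1 ^+ k.
    move=> i; apply: geometric_limit; first by rewrite mulr_ge0// ?expR_ge0.
    move=> k; apply: le_trans (step k t t0).
    by have := coord_le_norm (xs k.+1 t - xs k t) i 0; rewrite !mxE.
  exists (\col_i l i) => k _; apply: cV_norm_le; first by rewrite mulr_ge0.
  by move=> i; rewrite !mxE.
have Bmono s t : s <= t -> B s <= B t.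
  move=> st; rewrite /B !ler_wpM2l// ler_expR ler_wpM2l// mulr_ge0// ltW//.
pose y (t : R) := z (Num.max 0 t).
have yc : continuous y.
  move=> t; apply/cvgrPdist_le => e e0.
  have e3 : 0 < e / 3 by rewrite divr_gt0.
  have [k kP] := pow_half_small (B (`|t| + 1)) e3.
  have xkc : continuous (fun t : R => xs k (Num.max 0 t)).
    by apply: continuous_clamp0; exact: continuous_subspaceT.
  (* As [B] is increasing, one [k] serves for all times up to [|t| + 1]; this local uniformity makes
     the limit continuous. *)
  have zx s : s <= `|t| + 1 -> `|xs k (Num.max 0 s) - y s| <= e / 3.
    move=> st; apply: le_trans kP; apply: le_trans (zP _ _ _) _.
      by rewrite le_max lexx.
    rewrite ler_wpM2r// Bmono// ge_max st andbT addr_ge0//.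
  near=> s.
  have -> : y t - y s = - (xs k (Num.max 0 t) - y t) +
     (xs k (Num.max 0 t) - xs k (Num.max 0 s)) + (xs k (Num.max 0 s) - y s).
    by rewrite opprB !subrKA.
  rewrite (le_trans (ler_normD _ _))// (_ : e = e / 3 + e / 3 + e / 3); last by field.
  apply: lerD; last first.
    apply: zx; apply/ltW; near: s; apply: lt_nbhsl.
    by rewrite (le_lt_trans (ler_norm _))// ltrDl.
  apply: (le_trans (ler_normD _ _)); rewrite normrN; apply: lerD.
    by rewrite zx// (le_trans (ler_norm _))// lerDl.
  by near: s; exact: (cvgrPdist_le _ _).1 (xkc t) _ e3.
have [Xc X0 Xd] := SP _ yc; exists (S y); split=> // t t0.
(* The limit is a fixed point: [S y] and [y] are both within [B s / 2 ^ (k + 1)] of the iterate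
   [xs k.+1]. *)
suff Xz s : 0 <= s -> S y s = y s by rewrite (Xz t (ltW t0)); exact: Xd.
move=> s0; apply/eqP; rewrite -subr_eq0 -normr_le0.
apply/ler_addgt0Pl => e e0; rewrite addr0.
have [k kP] := pow_half_small (B s) e0; apply: le_trans kP.
have ys r : 0 <= r -> y r = z r by rewrite /y => r0; rewrite max_r.
have h1 : `|xs k.+1 s - S y s| <= B s * 2^-1 ^+ k / 2.
  have -> : B s * 2^-1 ^+ k / 2 = K * 2^-1 ^+ k * expR (2 * L * s) by rewrite /B; field.
  apply: (Scmp _ _ _ _ (xsc k) yc) => //; first by rewrite mulr_ge0.
  move=> r r0; rewrite (ys r (ltW r0)).
  have -> : 2 * (K * 2^-1 ^+ k) * expR (2 * L * r) = B r * 2^-1 ^+ k.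
    by rewrite /B; ring.
  by apply: zP; exact: ltW.
have h2 : `|xs k.+1 s - y s| <= B s * 2^-1 ^+ k / 2.
  by rewrite ys//; have := zP s k.+1 s0; rewrite exprS; lra.
have -> : S y s - y s = - (xs k.+1 s - S y s) + (xs k.+1 s - y s).
  by rewrite opprB addrA subrK.
rewrite (le_trans (ler_normD _ _))// normrN; lra.
Unshelve. all: by end_near. Qed.

End Picard.

(** * Clamped vector fields *)

Section Clamp.
Variable R : realType.

Lemma continuous_lipschitz_comp (T : topologicalType) (U V : normedModType R)
    (g : U -> V) (C : R) (u : T -> U) :
  0 <= C -> (forall x y, `|g x - g y| <= C * `|x - y|) -> continuous u ->
  continuous (g \o u).
Proof.
move=> C0 gC uc t; apply/cvgrPdist_le => e e0.
have C1 : 0 < C + 1 by rewrite ltr_wpDl.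
have e1 : 0 < (C + 1)^-1 * e by rewrite mulr_gt0// invr_gt0.
near=> s.
rewrite /= (le_trans (gC _ _))// (@le_trans _ _ ((C + 1) * `|u t - u s|))//.
  by rewrite ler_wpM2r// lerDl.
rewrite -ler_pdivlMl//; near: s.
exact: (cvgrPdist_le _ _).1 (uc t) _ e1.
Unshelve. all: by end_near. Qed.

Variable n : nat.

Definition clamp (rho : R) (x : 'cV[R]_n) : 'cV[R]_n :=
  \col_i Num.max (- rho) (Num.min rho (x i 0)).

Lemma clamp_id (rho : R) x : `|x| <= rho -> clamp rho x = x.
Proof.
move=> xrho; apply/colP => i; rewrite mxE.
have := le_trans (coord_le_norm x i 0) xrho; rewrite ler_norml => /andP[h1 h2].
by rewrite min_r// max_r.
Qed.

Lemma norm_clamp_le (rho : R) x : 0 <= rho -> `|clamp rho x| <= rho.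
Proof.
move=> rho0; apply: cV_norm_le => // i; rewrite mxE ler_norml.
by rewrite le_max lexx ge_max ge_min lexx/= (le_trans _ rho0)// oppr_le0.
Qed.

Lemma clamp_lipschitz (rho : R) x y : 0 <= rho ->
  `|clamp rho x - clamp rho y| <= `|x - y|.
Proof.
move=> rho0; apply: cV_norm_le => // i; rewrite !mxE.
have := coord_le_norm (x - y) i 0; rewrite !mxE.
set a := x i 0; set b := y i 0; set c := `|x - y|.
rewrite !ler_norml => /andP[h1 h2].
have mono (r s : R) : r <= s + c ->
    Num.max (- rho) (Num.min rho r) <= Num.max (- rho) (Num.min rho s) + c.
  move=> rs; have c0 : 0 <= c by rewrite /c.
  rewrite ge_max; apply/andP; split.
    by rewrite (@le_trans _ _ (- rho + c)) ?lerDl// lerD2r le_max lexx.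
  have [srho|srho] := leP rho s.
    rewrite (@le_trans _ _ rho) ?ge_min ?lexx//.
    by rewrite (@le_trans _ _ (rho + c)) ?lerDl// lerD2r le_max lexx orbT.
  rewrite (@le_trans _ _ r) ?ge_min ?lexx ?orbT// (le_trans rs)// lerD2r.
  by rewrite le_max lexx orbT.
have := mono a b; have := mono b a.
by move=> ba ab; apply/andP; split; [have := ba | have := ab]; lra.
Qed.

Lemma coord_le_enorm (q : nat) (x : 'cV[R]_q) i : `|x i 0| <= enorm x.
Proof.
rewrite -sqrtr_sqr /enorm ler_sqrt; last by rewrite sumr_ge0// => j _; rewrite sqr_ge0.
by rewrite (bigD1 i)//= lerDl sumr_ge0// => j _; rewrite sqr_ge0.
Qed.

Lemma norm_le_enorm (q : nat) (x : 'cV[R]_q) : `|x| <= enorm x.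
Proof. by apply: cV_norm_le => [|i]; [rewrite sqrtr_ge0 | exact: coord_le_enorm]. Qed.

(** Subtracting a primitive [I] of the input moves its jumps out of the equation: [y = x - I] obeys
    an equation whose right-hand side is continuous in time, to which the global Picard iteration
    applies. *)
Lemma clamped_solution (q : 'cV[mpoly.mpoly n R]_n) (rho : R) (v : R -> 'cV[R]_n)
    (x0 : 'cV[R]_n) : 0 <= rho -> piecewise_continuous v -> bounded_signal v ->
  exists x : R -> 'cV[R]_n, [/\ continuous x, x 0 = x0 &
    forall t : R, 0 < t -> {for t, continuous v} ->
      is_derive t (1 : R) x (pmxeval (clamp rho (x t)) q + v t)].
Proof.
move=> rho0 [vc _ _] [D vD].
have [|I [Ic I0 Id]] := @cV_primitive_exists R n v.
  move=> i; apply: (@integrable_finite_discont _ _ D).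
    move=> b; have [s sc] := vc b; exists s => t tb ts.
    by apply: continuous_coord; exact: sc.
  by move=> t t0; apply: le_trans (coord_le_enorm _ _) (vD t t0).
have [C C0 [Cb Cl]] := pmxeval_lipschitz q rho0.
pose h t y := pmxeval (clamp rho (y + I t)) q.
have C1 : 0 < C + 1 by rewrite ltr_wpDl.
have gl x y : `|pmxeval (clamp rho x) q - pmxeval (clamp rho y) q| <= C * `|x - y|.
  apply: le_trans (Cl _ _ (norm_clamp_le _ rho0) (norm_clamp_le _ rho0)) _.
  by rewrite ler_wpM2l// clamp_lipschitz.
have [||||y [yc y0 yd]] := @picard_global R n h (C + 1) C x0 C1.
- by [].
- move=> y yc.
  apply: (@continuous_lipschitz_comp _ _ _ (fun x => pmxeval (clamp rho x) q) C
    (fun t => y t + I t)) => //.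
  by move=> t; apply: continuousD; [exact: yc|exact: Ic].
- move=> t y z; apply: le_trans (gl _ _) _.
  by rewrite opprD addrACA subrr addr0 ler_wpM2r// lerDl.
- by move=> t y; apply: Cb; exact: norm_clamp_le.
exists (fun t => y t + I t); split.
- by move=> t; apply: continuousD; [exact: yc|exact: Ic].
- by rewrite I0 addr0.
- by move=> t t0 vt; exact: is_deriveD (yd t t0) (Id t t0 vt).
Qed.

End Clamp.

(** * Gains and a class KL bound *)

Section Gains.
Variable R : realType.

(** A class K function that is continuous on all of [R], so that compositions need no domain
    bookkeeping. *)
Definition gain (g : R -> R) : Prop :=
  [/\ continuous g, forall r s, 0 <= r -> r < s -> g r < g s & g 0 = 0].

Lemma gain_ge0 g r : gain g -> 0 <= r -> 0 <= g r.
Proof.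
move=> [_ gi g0]; rewrite le_eqVlt => /predU1P[<-|r0]; first by rewrite g0.
by rewrite ltW// -g0 gi.
Qed.

Lemma gain_le g r s : gain g -> 0 <= r -> r <= s -> g r <= g s.
Proof.
move=> [_ gi _] r0; rewrite le_eqVlt => /predU1P[->//|rs].
by rewrite ltW// gi.
Qed.

Lemma gain_comp f g : gain f -> gain g -> gain (g \o f).
Proof.
move=> fg gg; have [fc fi f0] := fg; have [gc gi g0] := gg; split.
- by move=> x; apply: continuous_comp; [exact: fc|exact: gc].
- by move=> r s r0 rs; apply: gi; [exact: gain_ge0 | exact: fi].
- by rewrite /= f0 g0.
Qed.

Lemma gain_scale c : 0 < c -> gain (fun r => c * r).
Proof.
move=> c0; split; first by move=> x; apply: cvgM; [exact: cvg_cst|exact: cvg_id].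
  by move=> r s _; rewrite ltr_pM2l.
by rewrite mulr0.
Qed.

Lemma gain_exp k : (0 < k)%N -> gain (fun r => r ^+ k).
Proof.
move=> k0; split; first exact: exprn_continuous.
  by move=> r s r0 rs; rewrite ltrXn2r// ?nnegrE// ?gt_eqF// (le_trans r0 (ltW rs)).
by rewrite expr0n gt_eqF.
Qed.

Lemma gain_sqrt : gain Num.sqrt.
Proof.
split; first exact: sqrt_continuous.
  by move=> r s r0 rs; rewrite ltr_sqrt// (le_lt_trans r0).
by rewrite sqrtr0.
Qed.

Lemma gain_id : gain id.
Proof. by split=> // x; exact: cvg_id. Qed.

Lemma gain_add f g : gain f -> gain g -> gain (fun r => f r + g r).
Proof.
move=> [fc fi f0] [gc gi g0]; split.
- by move=> x; apply: cvgD; [exact: fc|exact: gc].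
- by move=> r s r0 rs; apply: ltrD; [exact: fi|exact: gi].
- by rewrite f0 g0 addr0.
Qed.

Lemma gain_classK g : gain g -> classK g.
Proof. by move=> [gc gi g0]; split=> //; exact: continuous_subspaceT. Qed.

Variable p : nat.

(** The root of order [2 ^ p], as nested square roots. *)
Definition iroot (s : R) : R := iter p Num.sqrt s.
Local Notation K := (2 ^ p)%N.

Lemma gain_iroot : gain iroot.
Proof.
rewrite /iroot; elim: p => [|k ih]; first exact: gain_id.
exact: gain_comp ih gain_sqrt.
Qed.

Lemma iroot_exp s : 0 <= s -> iroot (s ^+ K) = s.
Proof.
rewrite /iroot; elim: p s => [|k ih] s s0; first by rewrite expn0 expr1.
by rewrite iterS expnS exprM ih ?exprn_ge0// sqrtr_sqr ger0_norm.
Qed.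

Lemma exp_iroot s : 0 <= s -> iroot s ^+ K = s.
Proof.
rewrite /iroot; elim: p s => [|k ih] s s0; first by rewrite expn0 expr1.
rewrite iterS expnS exprM sqr_sqrtr ?ih//.
by case: k {ih} => [|k] //=; exact: sqrtr_ge0.
Qed.

Lemma K_gt0 : (0 < K)%N. Proof. by rewrite expn_gt0. Qed.

Definition power_sum (s : R) : R := s + s ^+ K.
Definition root_sum (s : R) : R := s + iroot s.

Lemma gain_power_sum : gain power_sum.
Proof. by apply: gain_add; [exact: gain_id|apply: gain_exp; exact: K_gt0]. Qed.

Lemma gain_root_sum : gain root_sum.
Proof. by apply: gain_add; [exact: gain_id|exact: gain_iroot]. Qed.

Lemma max_le_power_sum s : 0 <= s -> Num.max s (s ^+ K) <= power_sum s.
Proof. by move=> s0; rewrite ge_max lerDl lerDr s0 exprn_ge0. Qed.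

Lemma le_root_sum s m : 0 <= s -> Num.min s (s ^+ K) <= m -> s <= root_sum m.
Proof.
move=> s0; rewrite ge_min => /orP[sm|sm].
  by rewrite /root_sum ler_wpDr// (gain_ge0 gain_iroot)// (le_trans s0).
have m0 : 0 <= m by rewrite (le_trans _ sm)// exprn_ge0.
rewrite /root_sum ler_wpDl// -{1}(iroot_exp s0).
by apply: (gain_le gain_iroot) => //; rewrite exprn_ge0.
Qed.

(** With [s = r ^+ 2], each power [s ^+ i] with [1 <= i <= j] lies between [s] and [s ^+ j], in an
    order decided by whether [s <= 1]. The bounds hold for every large [j] so that several gains can
    share one exponent. *)
Lemma even_gain_bounds mu (a : {poly R}) : 0 < mu -> is_even_gain mu a ->
  exists C k, 0 < C /\ forall j, (k <= j)%N -> forall r,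
    mu * Num.min (r ^+ 2) ((r ^+ 2) ^+ j) <= a.[r]
      <= C * Num.max (r ^+ 2) ((r ^+ 2) ^+ j).
Proof.
move=> mu0 [k [c [k1 c0 csum aE]]].
exists (\sum_(1 <= j < k.+1) c j), k; split; first exact: lt_le_trans csum.
move=> j kj r; set s := r ^+ 2; have s0 : 0 <= s by rewrite sqr_ge0.
have between i : (1 <= i < k.+1)%N ->
    Num.min s (s ^+ j) <= s ^+ i <= Num.max s (s ^+ j).
  move=> /andP[i1 ik]; have ij : (i <= j)%N by rewrite (leq_trans _ kj).
  rewrite ge_min le_max; have [s1|s1] := leP s 1.
    have -> : s ^+ i <= s by rewrite -[leRHS]expr1 ler_wiXn2l.
    by rewrite (ler_wiXn2l s0 s1 ij) orbT.
  have -> : s <= s ^+ i by rewrite -[leLHS]expr1 ler_weXn2l// ltW.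
  by rewrite (ler_weXn2l (ltW s1) ij) orbT.
have aE' : a.[r] = \sum_(1 <= i < k.+1) c i * s ^+ i.
  by rewrite aE; apply: eq_bigr => i _; rewrite exprM.
rewrite aE' mulr_suml; apply/andP; split.
  apply: (@le_trans _ _ (\sum_(1 <= i < k.+1) c i * Num.min s (s ^+ j))).
    by rewrite -mulr_suml ler_wpM2r// le_min s0 exprn_ge0.
  apply: ler_sum_nat => i ik; rewrite ler_wpM2l ?c0//.
  by case/andP: (between i ik).
apply: ler_sum_nat => i ik; rewrite ler_wpM2l ?c0//.
by case/andP: (between i ik).
Qed.

Section Decay.
Variable b : R.
Hypothesis b0 : 0 < b.

(* A class KL bound for the decay that is linear in time for large values and
   polynomial for small ones: decay_kernel u t dominates u - b t, and
   (1 + b t) * decay_kernel u t dominates u. *)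
Definition decay_kernel (u t : R) : R := u * (1 + u) / (1 + u + b * `|t|).

Let den_gt0 (u t : R) : 0 <= u -> 0 < 1 + u + b * `|t|.
Proof. by move=> u0; rewrite ltr_wpDr ?mulr_ge0 ?(ltW b0)// ltr_wpDr. Qed.

Lemma decay_kernel_ge0 (u t : R) : 0 <= u -> 0 <= decay_kernel u t.
Proof. by move=> u0; rewrite divr_ge0 ?(ltW (den_gt0 _ u0))// mulr_ge0// addr_ge0. Qed.

(** The right-hand side [y] acts as a level: a quantity starting at [u] and falling at rate
    [b min(y, 1) ^ K] is below [y] at time [t]. For [y <= 1] the reason is
    [u <= (1 + b t) * decay_kernel u t], for [y > 1] it is [u - b t <= decay_kernel u t]. *)
Lemma decay_kernel_fit (u t : R) : 0 <= u -> 0 <= t ->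
  u - b * t * Num.min (root_sum (decay_kernel u t)) 1 ^+ K <= root_sum (decay_kernel u t).
Proof.
move=> u0 t0; set y := root_sum _; have d0 := den_gt0 t u0.
have bt : 0 <= b * t by rewrite mulr_ge0// ltW.
have k0 := decay_kernel_ge0 t u0.
have r0 : 0 <= iroot (decay_kernel u t) := gain_ge0 gain_iroot k0.
have nt : `|t| = t by rewrite ger0_norm.
have y0 : 0 <= y by rewrite addr_ge0.
rewrite nt in d0.
have [y1|y1] := leP y 1.
  have yk : decay_kernel u t <= y ^+ K.
    by rewrite -{1}(exp_iroot k0) lerXn2r ?nnegrE// /y /root_sum lerDr.
  have yy : y ^+ K <= y by rewrite -{2}(expr1 y) ler_wiXn2l ?y0// K_gt0.
  suff : u <= decay_kernel u t * (1 + b * t).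
    have : decay_kernel u t * (1 + b * t) <= y ^+ K * (1 + b * t).
      by rewrite ler_wpM2r// addr_ge0.
    lra.
  rewrite /decay_kernel nt mulrAC ler_pdivlMr// -mulrA ler_wpM2l//.
  by have := mulr_ge0 u0 bt; lra.
rewrite expr1n mulr1.
suff : u - b * t <= decay_kernel u t by rewrite /y /root_sum; lra.
rewrite /decay_kernel nt ler_pdivlMr//.
have := mulr_ge0 bt bt; have := mulr_ge0 u0 bt; lra.
Qed.

Lemma decay_kernel_lt (u v t : R) : 0 <= u -> u < v -> decay_kernel u t < decay_kernel v t.
Proof.
move=> u0 uv; have v0 := le_trans u0 (ltW uv).
rewrite /decay_kernel ltr_pdivrMr ?den_gt0// mulrAC ltr_pdivlMr ?den_gt0//.
set B := b * `|t|; have B0 : 0 <= B by rewrite mulr_ge0// ltW.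
rewrite -subr_gt0.
have -> : v * (1 + v) * (1 + u + B) - u * (1 + u) * (1 + v + B) =
  (1 + u) * (1 + v) * (v - u) + B * ((v - u) * (1 + u + v)) by ring.
have u1 : 0 < 1 + u by rewrite ltr_pwDl.
have v1 : 0 < 1 + v by rewrite ltr_pwDl.
have vu : 0 < v - u by rewrite subr_gt0.
rewrite ltr_pwDl// ?mulr_gt0// mulr_ge0// mulr_ge0// ?ltW//; lra.
Qed.

Lemma decay_kernel_antitone (u s t : R) : 0 <= u -> 0 <= s -> s <= t ->
  decay_kernel u t <= decay_kernel u s.
Proof.
move=> u0 s0 st; have t0 := le_trans s0 st.
rewrite /decay_kernel ler_wpM2l ?mulr_ge0 ?addr_ge0// lef_pV2 ?posrE ?den_gt0//.
by rewrite lerD2l ler_wpM2l ?(ltW b0)// !ger0_norm.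
Qed.

Lemma decay_kernel_cvg0 (u : R) : 0 <= u -> decay_kernel u t @[t --> +oo] --> (0 : R).
Proof.
move=> u0; apply/cvgrPdist_le => e e0; near=> t.
rewrite sub0r normrN ger0_norm ?decay_kernel_ge0// /decay_kernel.
have t0 : 0 < t by near: t; exact: nbhs_pinfty_gt.
rewrite ler_pdivrMr ?den_gt0// gtr0_norm//.
have tb : u * (1 + u) <= e * (b * t).
  rewrite -ler_pdivrMl// -ler_pdivrMl//; apply/ltW; near: t; exact: nbhs_pinfty_gt.
apply: (le_trans tb); rewrite ler_wpM2l ?(ltW e0)// lerDr addr_ge0//.
Unshelve. all: by end_near. Qed.

(** Positivity of [f] on the whole line and the absolute value in the kernel keep the denominator
    positive everywhere, so joint continuity is proved on the full plane and then restricted. *)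
Lemma classKL_decay f g : gain f -> (forall r, 0 <= f r) -> gain g ->
  classKL (fun r t => g (decay_kernel (f r) t)).
Proof.
move=> fg fpos gg; have [fc fi f0] := fg; have [gc gi g0] := gg; split.
- apply: continuous_subspaceT => z.
  apply: (@continuous_comp _ _ _ (fun z : R * R => decay_kernel (f z.1) z.2) g); last exact: gc.
  have fz : f x.1 @[x --> z] --> f z.1.
    by apply: continuous_comp; [exact: cvg_fst|exact: fc].
  apply: cvgM.
    apply: cvgM => //; apply: cvgD => //; exact: cvg_cst.
  apply: cvgV; first by rewrite gt_eqF// den_gt0.
  apply: cvgD; first by apply: cvgD => //; exact: cvg_cst.
  apply: cvgM; first exact: cvg_cst.
  by apply: cvg_norm; exact: cvg_snd.
- move=> s s0; apply: gain_classK; split.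
  + move=> r; apply: (@continuous_comp _ _ _ (fun r => decay_kernel (f r) s) g); last exact: gc.
    apply: cvgM.
      apply: cvgM; first exact: fc.
      by apply: cvgD; [exact: cvg_cst|exact: fc].
    apply: cvgV; first by rewrite gt_eqF// den_gt0.
    apply: cvgD; last exact: cvg_cst.
    by apply: cvgD; [exact: cvg_cst|exact: fc].
  + move=> r r' r0 rr; apply: gi; first exact: decay_kernel_ge0.
    by apply: decay_kernel_lt => //; exact: fi.
  + by rewrite f0 /decay_kernel !mul0r g0.
- move=> r s t r0 s0 st; apply: gain_le => //; first exact: decay_kernel_ge0.
  exact: decay_kernel_antitone.
- move=> r r0; rewrite -g0; apply: (@cvg_comp _ _ _ (decay_kernel (f r)) g _ (nbhs 0)).
    exact: decay_kernel_cvg0.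
  exact: gc.
Qed.

End Decay.
End Gains.

(** * Input-to-state stability from dissipation *)

Section Lyapunov.
Variables (R : realType) (n : nat).

Lemma continuous_peval (T : topologicalType) (x : T -> 'cV[R]_n) p :
  continuous x -> continuous (fun t => peval (x t) p).
Proof.
move=> xc t; elim/mpoly_ring_ind: p => [c|i|p q ihp ihq|p q ihp ihq].
- have -> : (fun t => peval (x t) (mpoly.mpolyC n c)) = cst c.
    by apply/funext => s; exact: pevalC.
  exact: cvg_cst.
- have -> : (fun t => peval (x t) (mpoly.mpolyX R (mpoly.mnm1 i))) = (fun t => x t i 0).
    by apply/funext => s; exact: pevalX.
  by apply: continuous_coord; exact: xc.
- have -> : (fun t => peval (x t) (p + q)) = (fun t => peval (x t) p + peval (x t) q).
    by apply/funext => s; exact: pevalD.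
  exact: cvgD.
- have -> : (fun t => peval (x t) (p * q)) = (fun t => peval (x t) p * peval (x t) q).
    by apply/funext => s; exact: pevalM.
  exact: cvgM.
Qed.

Lemma poly_field_locally_lipschitz (q : 'cV[mpoly.mpoly n R]_n) :
  [locally [lipschitz pmxeval z.1 q + z.2 | z in setT
     : set ('cV[R]_n * 'cV[R]_n)%type]].
Proof.
move=> z _.
have r0 : 0 <= `|z| + 1 by rewrite addr_ge0.
have [C C0 [_ Cl]] := pmxeval_lipschitz q r0.
rewrite /lipschitz_on; near=> M.
have MC : C + 1 <= M by near: M; apply: nbhs_pinfty_ge; exact: num_real.
apply: (@filterS _ (nbhs z) _ (ball z 1)) (nbhsx_ballx _ _ _) => // u.
rewrite -ball_normE /ball_ /= => zu _.
have uz : `|u| <= `|z| + 1.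
  rewrite -[u](subrK z) addrC (le_trans (ler_normD _ _))// lerD2l.
  by rewrite -normrN opprB ltW.
have fst_le (A B : normedModType R) (a : A * B) : `|a.1| <= `|a|.
  by rewrite prod_normE le_max lexx.
have snd_le (A B : normedModType R) (a : A * B) : `|a.2| <= `|a|.
  by rewrite prod_normE le_max lexx orbT.
rewrite opprD addrACA (le_trans (ler_normD _ _))//.
apply: (@le_trans _ _ ((C + 1) * `|u.1 - u.2|)); last by rewrite ler_wpM2r.
rewrite mulrDl mul1r lerD//; last exact: (snd_le _ _ (u.1 - u.2)).
apply: (@le_trans _ _ (C * `|u.1.1 - u.2.1|)).
  apply: Cl; apply: le_trans uz; apply: le_trans (fst_le _ _ _) _.
    exact: fst_le.
  exact: snd_le.
by rewrite ler_wpM2l//; exact: (fst_le _ _ (u.1 - u.2)).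
Unshelve. all: by end_near. Qed.

Variables (q : 'cV[mpoly.mpoly n R]_n) (V : mpoly.mpoly n R) (mu C2 C4 : R) (p : nat).
Variables a3 a4 : 'cV[R]_n -> R.
Local Notation K := (2 ^ p)%N.
Local Notation sq x := (enorm x ^+ 2).
Hypotheses (mu0 : 0 < mu) (C20 : 0 < C2) (C40 : 0 < C4).
Hypothesis V_low : forall x : 'cV[R]_n, mu * Num.min (sq x) (sq x ^+ K) <= peval x V.
Hypothesis V_up : forall x : 'cV[R]_n, peval x V <= C2 * Num.max (sq x) (sq x ^+ K).
Hypothesis a3_low : forall x, mu * Num.min (sq x) (sq x ^+ K) <= a3 x.
Hypothesis a4_up : forall d, a4 d <= C4 * Num.max (sq d) (sq d ^+ K).
Hypothesis dissipation : forall x d : 'cV[R]_n,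
  (grad V x *m (pmxeval x q + d)) 0 0 <= a4 d - a3 x.

Let sq_ge0 m (x : 'cV[R]_m) : 0 <= sq x. Proof. by rewrite sqr_ge0. Qed.

Let min_ge0 (s : R) : 0 <= s -> 0 <= Num.min s (s ^+ K).
Proof. by move=> s0; rewrite le_min s0 exprn_ge0. Qed.

Let V_ge0 x : 0 <= peval x V.
Proof. by apply: le_trans (V_low x); rewrite mulr_ge0 ?(ltW mu0)// min_ge0. Qed.

(** The level of [V] above which [a3 >= 2 a4] for inputs of size at most [D]. From the inside out:
    bound [a4], compare with the lower bound of [a3], invert it to bound [|x|^2], and convert this
    to a bound on [V]. *)
Definition level_gain (D : R) : R :=
  C2 * power_sum p (root_sum p (2 * C4 / mu * power_sum p (D ^+ 2))).

Lemma gain_level_gain : gain level_gain.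
Proof.
have c0 : 0 < 2 * C4 / mu by rewrite divr_gt0// mulr_gt0.
have g2 : gain (fun r : R => r ^+ 2) by exact: gain_exp.
have := gain_comp (gain_comp (gain_comp (gain_comp (gain_comp g2 (gain_power_sum R p))
  (gain_scale c0)) (gain_root_sum R p)) (gain_power_sum R p)) (gain_scale C20).
by [].
Qed.

Definition state_gain (m : R) : R := Num.sqrt (root_sum p (m / mu)).

Lemma enorm_le_state_gain x m : peval x V <= m -> enorm x <= state_gain m.
Proof.
move=> Vm; have : sq x <= root_sum p (m / mu).
  apply: le_root_sum => //; rewrite ler_pdivlMr// mulrC.
  exact: le_trans (V_low x) Vm.
move=> sm; rewrite /state_gain -(ger0_norm (sqrtr_ge0 _ : 0 <= enorm x)) -sqrtr_sqr.
by rewrite ler_sqrt// (le_trans (sq_ge0 x)).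
Qed.

Lemma gain_state_gain : gain state_gain.
Proof.
have i0 : 0 < mu^-1 by rewrite invr_gt0.
have [c h z] := gain_comp (gain_comp (gain_scale i0) (gain_root_sum R p)) (gain_sqrt R).
have -> : state_gain = Num.sqrt \o (root_sum p \o (fun r => mu^-1 * r)).
  by apply/funext => m; rewrite /state_gain mulrC.
by split.
Qed.

(** Above the level half of [a3] pays for [a4], and the other half is left as a decay rate expressed
    through [V]. *)
Lemma V_decay x d D : 0 <= D -> enorm d <= D -> level_gain D < peval x V ->
  (grad V x *m (pmxeval x q + d)) 0 0 <= - (mu / 2 * Num.min (peval x V / C2) 1 ^+ K).
Proof.
move=> D0 dD LV; apply: (le_trans (dissipation x d)).
have s0 := sq_ge0 x; set s := sq x in s0.
have VC : peval x V / C2 <= Num.max s (s ^+ K) by rewrite ler_pdivrMr// mulrC V_up.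
have a4D : a4 d <= C4 * power_sum p (D ^+ 2).
  apply: (le_trans (a4_up d)); rewrite ler_wpM2l ?(ltW C40)//.
  apply: (le_trans (max_le_power_sum p (sq_ge0 d)));
  apply: gain_le => //; first exact: gain_power_sum.
  by rewrite lerXn2r ?nnegrE// sqrtr_ge0.
have small : 2 * C4 / mu * power_sum p (D ^+ 2) < Num.min s (s ^+ K).
  rewrite ltNge; apply/negP => /(le_root_sum s0) sle.
  move: LV; rewrite ltNge => /negP; apply; rewrite /level_gain.
  apply: (le_trans (V_up x)); rewrite ler_wpM2l ?(ltW C20)//.
  apply: (le_trans (max_le_power_sum p s0)); apply: gain_le => //; exact: gain_power_sum.
have a3s := a3_low x; rewrite -/s in a3s.
have a4a3 : 2 * a4 d <= mu * Num.min s (s ^+ K).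
  have : mu * (2 * C4 / mu * power_sum p (D ^+ 2)) <= mu * Num.min s (s ^+ K).
    by rewrite ler_wpM2l ?(ltW mu0)// ltW.
  have -> : mu * (2 * C4 / mu * power_sum p (D ^+ 2)) = 2 * (C4 * power_sum p (D ^+ 2)).
    by field; rewrite gt_eqF.
  lra.
(* For [s <= 1] the maximum in [VC] is [s], so [V / C2 <= s]; for [s > 1] truncation at 1
   suffices. *)
have : Num.min (peval x V / C2) 1 ^+ K <= Num.min s (s ^+ K).
  have V0 : 0 <= peval x V / C2 by rewrite divr_ge0// ltW.
  have m0 : 0 <= Num.min (peval x V / C2) 1 by rewrite le_min V0 ler01.
  have [s1|s1] := leP s 1.
    have sK : s ^+ K <= s by rewrite -[leRHS]expr1 ler_wiXn2l// K_gt0.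
    rewrite [leRHS]min_r// lerXn2r ?nnegrE// (le_trans _ (_ : peval x V / C2 <= s))//.
      by rewrite ge_min lexx.
    by move: VC; rewrite max_l.
  have sK : s <= s ^+ K by rewrite -[leLHS]expr1 ler_weXn2l ?(ltW s1)// K_gt0.
  rewrite [leRHS]min_l// (le_trans _ (ltW s1))// exprn_ile1//.
  by rewrite ge_min lexx orbT.
move=> mm; have := ler_wpM2l (ltW mu0) mm; lra.
Qed.

Lemma decay_rate_ge0 y : 0 <= y -> 0 <= mu / 2 * Num.min y 1 ^+ K.
Proof. by move=> y0; rewrite mulr_ge0 ?divr_ge0 ?(ltW mu0)// exprn_ge0// le_min y0 ler01. Qed.

Section Trajectory.
Variables (v : R -> 'cV[R]_n) (D : R) (x0 : 'cV[R]_n).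
Hypotheses (v_pc : piecewise_continuous v) (v_bd : forall t, 0 <= t -> enorm (v t) <= D).

Let D0 : 0 <= D.
Proof. exact: le_trans (sqrtr_ge0 _) (v_bd (lexx 0)). Qed.

Let F (x d : 'cV[R]_n) := pmxeval x q + d.

Lemma solution_exists : exists x, is_solution F v x0 x.
Proof.
(* Level [c] is never crossed. The field is clamped outside a box containing the sublevel set of
   [c + 1], so the whole band used by [barrier] is left unclamped. *)
pose c := Num.max (peval x0 V) (level_gain D).
have c0 : 0 <= c by rewrite le_max V_ge0.
have [vc _ _] := v_pc.
have rho0 : 0 <= state_gain (c + 1) by rewrite sqrtr_ge0.
have vb : bounded_signal v by exists D.
have [x [xc xx0 xd]] := clamped_solution q x0 rho0 v_pc vb.
have inside t : peval (x t) V <= c + 1 -> clamp (state_gain (c + 1)) (x t) = x t.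
  move=> /enorm_le_state_gain h; apply: clamp_id.
  exact: le_trans (norm_le_enorm _) h.
have Vc : forall t, 0 <= t -> peval (x t) V <= c.
  apply: (@barrier R (fun t => peval (x t) V)).
  - exact: continuous_peval.
  - by rewrite xx0 le_max lexx.
  move=> b; have [s sc] := vc b; exists s => t tb ts /andP[cw wc].
  have /andP[t0 _] := tb; have xt := xd t t0 (sc t tb ts).
  rewrite (inside t (ltW wc)) in xt.
  exists ((grad V (x t) *m (pmxeval (x t) q + v t)) 0 0); first exact: is_derive_peval.
  have Lw : level_gain D < peval (x t) V by rewrite (le_lt_trans _ cw)// le_max lexx orbT.
  apply: (le_trans (V_decay D0 (v_bd (ltW t0)) Lw)).
  by rewrite oppr_le0 decay_rate_ge0// divr_ge0// ltW.
exists x; split=> //; first exact: continuous_subspaceT.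
move=> t t0 vt; have := xd t t0 vt; rewrite inside//.
by rewrite (le_trans (Vc t (ltW t0)))// lerDl.
Qed.

Lemma solution_estimate x : is_solution F v x0 x -> forall t, 0 <= t ->
  enorm (x t) <=
    state_gain (C2 * root_sum p (decay_kernel (mu / (2 * C2)) (power_sum p (sq x0)) t))
    + state_gain (level_gain D).
Proof.
move=> [xx0 xc xd] t t0; have [vc _ _] := v_pc.
pose y (s : R) := x (Num.max 0 s).
have yc : continuous y by exact: continuous_clamp0.
have yx s : 0 <= s -> y s = x s by move=> s0; rewrite /y max_r.
have yd s : 0 < s -> {for s, continuous v} -> is_derive s (1 : R) y (F (y s) (v s)).
  move=> s0 vs; rewrite yx ?ltW//; apply: near_eq_is_derive (xd s s0 vs).
  by near=> r; rewrite yx//; apply/ltW; near: r; exact: lt_nbhsr.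
(* The rate [mu / 2] rescaled to [V / C2], the scale in which [u] bounds the initial value. *)
set b := mu / (2 * C2); set u := power_sum p (sq x0).
set Y := root_sum p (decay_kernel b u t).
have b0 : 0 < b by rewrite divr_gt0// mulr_gt0.
have u0 : 0 <= u by apply: gain_ge0 => //; exact: gain_power_sum.
have Y0 : 0 <= Y by apply: gain_ge0; [exact: gain_root_sum|exact: decay_kernel_ge0].
(* The final time [t] is fixed, and the target level [eta] depends on it. As long as [V] exceeds
   [eta] it falls at least at the constant rate [a], and [decay_kernel_fit] says that time [t]
   suffices to reach [eta]. *)
pose L := level_gain D; pose eta := Num.max L (C2 * Y).
have etaY : Y <= eta / C2 by rewrite ler_pdivlMr// mulrC le_max lexx orbT.
have eta0 : 0 <= eta / C2 := le_trans Y0 etaY.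
pose a := mu / 2 * Num.min (eta / C2) 1 ^+ K.
have minS (r s : R) : 0 <= r -> r <= s -> Num.min r 1 ^+ K <= Num.min s 1 ^+ K.
  move=> r0 rs; rewrite lerXn2r ?nnegrE ?le_min ?r0 ?ler01 ?(le_trans r0 rs)//.
  by rewrite !ge_min rs lexx orbT.
have : peval (y t) V <= Num.max eta (peval (y 0) V - a * t).
  apply: (@decay R (fun t => peval (y t) V)) => //.
  - exact: continuous_peval.
  - exact: decay_rate_ge0.
  move=> c; have [s sc] := vc c; exists s => r rc rs etaw.
  have /andP[r0 _] := rc; have yr := yd r r0 (sc r rc rs).
  exists ((grad V (y r) *m F (y r) (v r)) 0 0); first exact: is_derive_peval.
  have Lw : level_gain D < peval (y r) V by rewrite (le_lt_trans _ etaw)// le_max lexx.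
  apply: (le_trans (V_decay D0 (v_bd (ltW r0)) Lw)).
  rewrite lerN2 /a ler_wpM2l ?divr_ge0 ?(ltW mu0)//; apply: minS => //.
  by rewrite ler_pM2r ?invr_gt0// ltW.
rewrite !yx// xx0 => Vt.
have VE : peval (x t) V <= eta.
  move: Vt; rewrite le_max => /orP[//|Vt].
  apply: (le_trans Vt); rewrite le_max; apply/orP; right.
  have fit := decay_kernel_fit p b0 u0 t0; rewrite -/Y in fit.
  have V0u : peval x0 V <= C2 * u.
    by apply: (le_trans (V_up x0)); rewrite ler_wpM2l ?(ltW C20)// max_le_power_sum.
  have aY : C2 * (b * t * Num.min Y 1 ^+ K) <= a * t.
    have -> : C2 * (b * t * Num.min Y 1 ^+ K) = mu / 2 * Num.min Y 1 ^+ K * t.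
      by rewrite /b; field; rewrite gt_eqF.
    by rewrite ler_wpM2r// ler_wpM2l ?divr_ge0 ?(ltW mu0)//; exact: minS.
  have := ler_wpM2l (ltW C20) fit; lra.
have := enorm_le_state_gain VE; rewrite /eta.
have sg0 m : 0 <= state_gain m by rewrite sqrtr_ge0.
by rewrite /Num.max; case: ifP => _ h; apply: (le_trans h); rewrite ?lerDl ?lerDr.
Unshelve. all: by end_near. Qed.

End Trajectory.

Lemma iss_lyapunov : pmxeval 0 q = 0 -> iss (fun x d => pmxeval x q + d).
Proof.
move=> q0; split; first by rewrite q0 addr0.
  exact: poly_field_locally_lipschitz.
have g2 : gain (fun r : R => r ^+ 2) by exact: gain_exp.
have b0 : 0 < mu / (2 * C2) by rewrite divr_gt0// mulr_gt0.
have gf := gain_comp g2 (gain_power_sum R p).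
have gg := gain_comp (gain_comp (gain_root_sum R p) (gain_scale C20)) gain_state_gain.
exists (fun r t =>
  state_gain (C2 * root_sum p (decay_kernel (mu / (2 * C2)) (power_sum p (r ^+ 2)) t))).
exists (state_gain \o level_gain); split.
- apply: (classKL_decay b0 gf _ gg) => r.
  exact: gain_ge0 (gain_power_sum R p) (sqr_ge0 r).
- exact: gain_classK (gain_comp gain_level_gain gain_state_gain).
move=> x0 v v_pc [C vC]; set A := [set _ | _ in _].
have vA t : 0 <= t -> enorm (v t) <= sup A.
  move=> t0; apply: ub_le_sup; last by exists t.
  by exists C => _ [s s0 <-]; exact: vC.
split; first exact: (solution_exists x0 v_pc vA).
by move=> x xsol t t0; exact: (solution_estimate v_pc vA xsol).
Qed.

End Lyapunov.

(** * From the certificate to stability for every system in the ellipsoid *)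

Theorem theorem4p3 (R : realType) (n m N M T : nat)
  (Z : 'cV[mpoly.mpoly n R]_N) (W : 'M[mpoly.mpoly n R]_(M, m))
  (Z_monomial : forall i j, is_monomial (Z i j))
  (W_monomial : forall i j, is_monomial (W i j))
  (Z_0 : pmxeval 0 Z = 0)
  (Astar : 'M[R]_(n, N)) (Bstar : 'M[R]_(n, M))
  (delta : R) (delta_gt0 : 0 < delta)
  (us : 'I_T -> 'cV[R]_m) (xs dxs : 'I_T -> 'cV[R]_n)
  (data_ok : forall i, exists2 di : 'cV[R]_n,
     enorm di ^+ 2 <= delta &
     dxs i = Astar *m pmxeval (xs i) Z
             + Bstar *m pmxeval (xs i) W *m us i + di)
  (opt_feas : exists A B tau, opt_feasible Z W delta us xs dxs A B tau)
  (Abar : 'M[R]_(N + M)) (Bbar : 'M[R]_(N + M, n))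
  (opt_sol : opt_solution Z W delta us xs dxs Abar Bbar)
  (zetabar := - (invmx Abar *m Bbar)) (Qbar := 1%:M : 'M[R]_n)
  (mu : R) (mu_gt0 : 0 < mu)
  (k : 'cV[mpoly.mpoly n R]_m) (k_0 : pmxeval 0 k = 0)
  (alpha1 alpha2 alpha3 alpha4 : {poly R})
  (V : mpoly.mpoly n R) (lambda : mpoly.mpoly (n + n) R)
  (s_alpha1 s_alpha2 : mpoly.mpoly n R) (s_lambda : mpoly.mpoly (n + n) R)
  (S_nabla : 'M[mpoly.mpoly (n + n) R]_(1 + (n + (N + M))))
  (s_alpha1_sos : is_sos s_alpha1) (s_alpha2_sos : is_sos s_alpha2)
  (s_lambda_sos : is_sos s_lambda) (S_nabla_sos : is_sos_mx S_nabla)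
  (alpha1_gain : is_even_gain mu alpha1)
  (alpha2_gain : is_even_gain mu alpha2)
  (alpha3_gain : is_even_gain mu alpha3)
  (alpha4_gain : is_even_gain mu alpha4)
  (V_lower : forall x : 'cV[R]_n,
     peval x V - alpha1.[enorm x] = peval x s_alpha1)
  (V_upper : forall x : 'cV[R]_n,
     alpha2.[enorm x] - peval x V = peval x s_alpha2)
  (lambda_lower : forall x d : 'cV[R]_n,
     peval (col_mx x d) lambda - mu = peval (col_mx x d) s_lambda)
  (V_decrease : forall x d : 'cV[R]_n,
     let ell := regressor Z W x (pmxeval x k) in
     let lam := peval (col_mx x d) lambda in
     sym_block3
       ((alpha3.[enorm x] - alpha4.[enorm d])%:M
        + grad V x *m (zetabar^T *m ell + d))
       (mxsqrt Qbar *m (grad V x)^T) ((- 2 * lam)%:M)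
       (lam *: (invmx (mxsqrt Abar) *m ell)) 0 ((- 2 * lam)%:M)
     = - pmxeval (col_mx x d) S_nabla) :
  (forall (A : 'M[R]_(n, N)) (B : 'M[R]_(n, M)),
     Ibar Abar Bbar (row_mx A B) -> iss (closed_loop Z W k (row_mx A B)))
  /\ Ibar Abar Bbar (row_mx Astar Bstar)
  /\ iss (closed_loop Z W k (row_mx Astar Bstar)).
Proof.
have [tau feas _] := opt_sol; have [Apd _ _] := feas.
have star : Ibar Abar Bbar (row_mx Astar Bstar) by exact: Ibar_true data_ok feas.
suff all_iss AB : Ibar Abar Bbar AB -> iss (closed_loop Z W k AB).
  by split=> [A B|]; [exact: all_iss|split=> //; exact: all_iss].
move=> ABI; have [q qE] := regressor_pmxeval Z W k AB.
have -> : closed_loop Z W k AB = (fun x d => pmxeval x q + d).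
  by apply/funext => x; apply/funext => d; rewrite /closed_loop qE.
have q0 : pmxeval 0 q = 0.
  by rewrite -qE /regressor Z_0 k_0 mulmx0 col_mx0 mulmx0.
have [C1 [k1 [_ B1]]] := even_gain_bounds mu_gt0 alpha1_gain.
have [C2 [k2 [C20 B2]]] := even_gain_bounds mu_gt0 alpha2_gain.
have [C3 [k3 [_ B3]]] := even_gain_bounds mu_gt0 alpha3_gain.
have [C4 [k4 [C40 B4]]] := even_gain_bounds mu_gt0 alpha4_gain.
(* Since [p <= 2 ^ p], the exponent [2 ^ p] exceeds the thresholds of all four gains. *)
pose p := maxn (maxn k1 k2) (maxn k3 k4).
have pK i : (i <= p)%N -> (i <= 2 ^ p)%N.
  by move=> ip; rewrite (leq_trans ip)// ltnW// ltn_expl.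
have /pK K1 : (k1 <= p)%N by rewrite !leq_max leqnn.
have /pK K2 : (k2 <= p)%N by rewrite !leq_max leqnn ?orbT.
have /pK K3 : (k3 <= p)%N by rewrite !leq_max leqnn ?orbT.
have /pK K4 : (k4 <= p)%N by rewrite !leq_max leqnn ?orbT.
apply: (@iss_lyapunov R n q V mu C2 C4 p (fun x => alpha3.[enorm x])
  (fun d => alpha4.[enorm d])) => //.
- move=> x; have /andP[h _] := B1 _ K1 (enorm x); apply: (le_trans h).
  by have := sos_ge0 x s_alpha1_sos; rewrite -V_lower subr_ge0.
- move=> x; have /andP[_ h] := B2 _ K2 (enorm x); apply: le_trans h.
  by have := sos_ge0 x s_alpha2_sos; rewrite -V_upper subr_ge0.
- by move=> x; have /andP[] := B3 _ K3 (enorm x).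
- by move=> d; have /andP[] := B4 _ K4 (enorm d).
move=> x d; rewrite -qE.
have lam0 : 0 < peval (col_mx x d) lambda.
  rewrite (lt_le_trans mu_gt0)//.
  by have := sos_ge0 (col_mx x d) s_lambda_sos; rewrite -lambda_lower subr_ge0.
(* The square root of the identity enters only as a positive semidefinite matrix whose square is the
   identity. *)
have psd1 : psd (1%:M : 'M[R]_n).
  by split=> [|v]; [rewrite trmx1 | rewrite mulmx1; exact: dot_ge0].
have [psdQ QQ] := mxsqrtP psd1.
have [psdA AA] := mxsqrtP (pd_psd Apd).
have /(_ psdQ QQ psdA AA) := @robust_decrease R n (N + M) Abar Bbar AB
  (mxsqrt 1%:M) (mxsqrt Abar) (grad V x) d (regressor Z W x (pmxeval x k))
  (alpha3.[enorm x] - alpha4.[enorm d]) (peval (col_mx x d) lambda) Apd.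
move=> /(_ (fun v => Ibar_complete_square v Apd ABI) lam0) H.
suff : alpha3.[enorm x] - alpha4.[enorm d] +
  (grad V x *m (AB *m regressor Z W x (pmxeval x k) + d)) 0 0 <= 0 by lra.
apply: H => v; have /= -> := V_decrease x d.
by rewrite bilN oppr_le0; exact: sos_mx_ge0.
Qed.
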